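(* Let $\{\varphi_j\}_{j=1}^r$ be any basis of $H^0\big(\mathcal X\otimes\sqrt{\mathcal K}(\Xi)\big)$, where $\Xi$ is the divisor of poles of the degree-$r$ map $Z:\mathcal C\to\mathbb C\mathbb P^1$, and let $\Phi(z)=\big[\varphi_j(z^{(a)})\big]_{j,a=1}^r$. Then the determinant $\det\Phi(z)$ vanishes only at the critical values of $Z$, and to minimal order in the following sense: for any collection $\psi_1,\dots,\psi_r$ of meromorphic sections of $\mathcal X\otimes\sqrt{\mathcal K}$ with poles away from the ramification points of the map $Z$, the ratio $$F(z):=\frac{\det\big[\psi_j(z^{(a)})\big]_{j,a=1}^r}{\det\Phi(z)}$$ is a rational function of $z$ without poles at the critical values of $Z$ (i.e. the determinant in the numerator is ''divisible'' by $\det\Phi$).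
   Context: $\mathcal C$ is a compact Riemann surface of genus $g$ with canonical bundle $\mathcal K$, and $\sqrt{\mathcal K}$ is a fixed holomorphic square root of $\mathcal K$ with $h^0(\sqrt{\mathcal K})=0$. $\mathcal X$ is a flat line bundle given by a unitary character $\mathcal X:\pi_1(\mathcal C)\to U(1)$, with the standing assumption $h^0(\mathcal X\otimes\sqrt{\mathcal K})=0$ (equivalently, the corresponding point of the Jacobian is not on the theta divisor). For a divisor $\mathscr D$, $H^0(\mathcal X\otimes\sqrt{\mathcal K}(\mathscr D))$ is the space of meromorphic sections $\varphi$ of $\mathcal X\otimes\sqrt{\mathcal K}$ with $\mathrm{div}(\varphi)\ge-\mathscr D$; its dimension is $\deg\mathscr D$ for positive $\mathscr D$. $Z:\mathcal C\to\mathbb C\mathbb P^1$ is a meromorphic function of degree $r$ with polar divisor $\Xi$ ($\deg\Xi=r$). Ramification points are the points $p\in\mathcal C$ where $\mathrm dZ(p)=0$, and critical values are the values of $Z$ at the ramification points. The $z$-plane is cut along a dissection so that $\mathcal C$ is represented by $r$ copies (sheets) of the cut plane, appropriately identified along the cuts; $z^{(a)}$, $a=1,\dots,r$, denotes the point of $Z^{-1}(z)$ on the $a$-th sheet. For a section $\varphi$, $\varphi(z^{(a)})$ denotes its value in the fibre of $\mathcal X\otimes\sqrt{\mathcal K}$ at $z^{(a)}$; in the determinants, all entries of the $a$-th column lie in the same one-dimensional fibre, so vanishing of a determinant is meaningful and ratios of two such determinants are numbers.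
   Formalization: That F has no pole at a critical value v is claimed only if no ψ_j has a pole at any point of Z^{-1}(v), not just at ramification points; else it fails: genus 0, Z=x³−x², ψ_j=√dx/(x−c_j), c=(1,5,7) gives F a pole at the critical value 0. *)

(* Defs.v *)
From HB Require Import structures.
From mathcomp Require Export all_boot all_order all_algebra.
From mathcomp Require Export all_classical all_reals all_analysis.
From mathcomp Require Export complex.
Export numFieldNormedType.Exports.

Set Implicit Arguments.
Unset Strict Implicit.
Unset Printing Implicit Defensive.

Import Order.TTheory GRing.Theory Num.Theory.

Local Open Scope classical_set_scope.
Local Open Scope ring_scope.

(* The analysis library puts a topology on the carrier of a numClosedFieldType
   structure, not on the bare type R[i]; hence this folded definition. *)
Definition Cplx (R : realType) : numClosedFieldType := R[i].

Definition holomorphic_at (R : realType) (f : Cplx R -> Cplx R) (z : Cplx R) :=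
  \forall w \near z, derivable f w 1.

Definition analytic_at (R : realType) (h : Cplx R -> Cplx R) (z : Cplx R) :=
  exists a : nat -> Cplx R, \forall w \near z,
    series (fun k => a k * (w - z) ^+ k) @ \oo --> h w.

Record atlas (R : realType) (X : topologicalType) := Atlas {
  chart : Type;
  dom : chart -> set X;
  coord : chart -> X -> Cplx R;
  param : chart -> Cplx R -> X;
  dom_open : forall i, open (dom i);
  dom_cover : forall p, exists i, dom i p;
  coord_open : forall i, open (coord i @` dom i);
  coordK : forall i p, dom i p -> param i (coord i p) = p;
  coord_cont : forall i p, dom i p -> {for p, continuous (coord i)};
  param_cont : forall i p, dom i p -> {for coord i p, continuous (param i)};
  transition_holo : forall i j p, dom i p -> dom j p ->
    holomorphic_at (coord j \o param i) (coord i p) }.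

Definition compact_riemann_surface (R : realType) (X : topologicalType)
    (A : atlas R X) :=
  [/\ hausdorff_space X, connected [set: X] & compact [set: X]].

(* Expansion of f at p in the coordinate of the chart i: h is the analytic factor of a Laurent expansion with finite principal part;
   the value of f at p itself is not constrained. *)
Definition laurent (R : realType) (X : topologicalType) (A : atlas R X)
    (i : chart A) (f : X -> Cplx R) (p : X) (n : int) (h : Cplx R -> Cplx R) :=
  analytic_at h (coord i p) /\
  \forall q \near p^', f q = (coord i q - coord i p) ^ n * h (coord i q).

(* The germ of f at p may be identically zero (order +oo). *)
Definition ord_ge (R : realType) (X : topologicalType) (A : atlas R X)
    (i : chart A) (f : X -> Cplx R) (p : X) (n : int) :=
  exists h, laurent i f p n h.

Definition ord_eq (R : realType) (X : topologicalType) (A : atlas R X)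
    (i : chart A) (f : X -> Cplx R) (p : X) (n : int) :=
  exists2 h, laurent i f p n h & h (coord i p) != 0.

Definition pole_at (R : realType) (X : topologicalType) (A : atlas R X)
    (i : chart A) (f : X -> Cplx R) (p : X) :=
  exists2 n : int, n < 0 & ord_eq i f p n.

(* Unlike [ord_ge i f p 0], this also requires the right value at p. *)
Definition regular_at (R : realType) (X : topologicalType) (A : atlas R X)
    (i : chart A) (f : X -> Cplx R) (p : X) :=
  exists2 h, analytic_at h (coord i p) & \forall q \near p, f q = h (coord i q).

(* Line bundles are trivialized over the charts; a section has local
   representatives s i with s i = g i j * s j on overlaps. *)

Definition cocycle (R : realType) (X : topologicalType) (A : atlas R X) :=
  chart A -> chart A -> X -> Cplx R.

Definition section (R : realType) (X : topologicalType) (A : atlas R X) :=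
  chart A -> X -> Cplx R.

Definition is_cocycle (R : realType) (X : topologicalType) (A : atlas R X)
    (g : cocycle A) :=
  (forall i p, dom i p -> g i i p = 1) /\
  (forall i j k p, dom i p -> dom j p -> dom k p ->
     g i k p = g i j p * g j k p).

Definition holomorphic_bundle (R : realType) (X : topologicalType)
    (A : atlas R X) (g : cocycle A) :=
  is_cocycle g /\
  (forall i j p, dom i p -> dom j p ->
     holomorphic_at (g i j \o param i) (coord i p)).

Definition flat_bundle (R : realType) (X : topologicalType)
    (A : atlas R X) (g : cocycle A) :=
  is_cocycle g /\
  (forall i j p, dom i p -> dom j p -> \forall q \near p, g i j q = g i j p).

Definition tensor (R : realType) (X : topologicalType) (A : atlas R X)
    (g g' : cocycle A) : cocycle A :=
  fun i j p => g i j p * g' i j p.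

(* Representatives f i of a section stand for the differential f i dz_i. *)
Definition canonical_bundle (R : realType) (X : topologicalType)
    (A : atlas R X) : cocycle A :=
  fun i j p => derive1 (coord j \o param i) (coord i p).

Definition bundle_iso (R : realType) (X : topologicalType) (A : atlas R X)
    (g g' : cocycle A) :=
  exists u : chart A -> X -> Cplx R,
    (forall i p, dom i p ->
       u i p != 0 /\ holomorphic_at (u i \o param i) (coord i p)) /\
    (forall i j p, dom i p -> dom j p -> u i p * g i j p = g' i j p * u j p).

Definition is_sqrt_canonical (R : realType) (X : topologicalType)
    (A : atlas R X) (S : cocycle A) :=
  holomorphic_bundle S /\ bundle_iso (tensor S S) (@canonical_bundle R X A).

Definition is_loop (R : realType) (X : topologicalType) (x : X) (c : R -> X) :=
  [/\ {within `[0, 1], continuous c}, c 0 = x & c 1 = x].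

Definition loop_homotopic (R : realType) (X : topologicalType) (x : X)
    (c c' : R -> X) :=
  exists H : R * R -> X,
    [/\ {within `[0, 1] `*` `[0, 1], continuous H},
        forall t, t \in `[0, 1] -> H (0, t) = c t /\ H (1, t) = c' t
      & forall s, s \in `[0, 1] -> H (s, 0) = x /\ H (s, 1) = x].

Definition loop_concat (R : realType) (X : topologicalType) (c c' : R -> X) :
    R -> X :=
  fun t => if t <= 2^-1 then c (2 * t) else c' (2 * t - 1).

(* chi : pi_1(X, x) -> U(1), as a function on loops at x. *)
Definition unitary_character (R : realType) (X : topologicalType) (x : X)
    (chi : (R -> X) -> Cplx R) :=
  [/\ forall c, is_loop x c -> `|chi c| = 1,
      forall c c', is_loop x c -> is_loop x c' -> loop_homotopic x c c' ->
        chi c = chi c'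
    & forall c c', is_loop x c -> is_loop x c' ->
        chi (loop_concat c c') = chi c * chi c'].

(* s is a section along the path c that is parallel for the flat connection. *)
Definition flat_along (R : realType) (X : topologicalType) (A : atlas R X)
    (g : cocycle A) (c : R -> X) (s : chart A -> R -> Cplx R) :=
  (forall i t, t \in `[0, 1] -> dom i (c t) ->
     \forall t' \near t, t' \in `[0, 1] -> s i t' = s i t) /\
  (forall i j t, t \in `[0, 1] -> dom i (c t) -> dom j (c t) ->
     s i t = g i j (c t) * s j t).

Definition has_holonomy (R : realType) (X : topologicalType) (A : atlas R X)
    (g : cocycle A) (x : X) (chi : (R -> X) -> Cplx R) :=
  forall c s, is_loop x c -> flat_along g c s ->
    forall i, dom i x -> s i 1 = chi c * s i 0.

Definition flat_unitary_bundle (R : realType) (X : topologicalType)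
    (A : atlas R X) (x : X) (chi : (R -> X) -> Cplx R) (g : cocycle A) :=
  [/\ unitary_character x chi, flat_bundle g & has_holonomy g x chi].

(* The values of the representatives at poles carry no information. *)
Definition meromorphic_section (R : realType) (X : topologicalType)
    (A : atlas R X) (g : cocycle A) (s : section A) :=
  (forall i j p, dom i p -> dom j p -> s i p = g i j p * s j p) /\
  (forall i p, dom i p -> regular_at i (s i) p \/ pole_at i (s i) p).

Definition has_pole (R : realType) (X : topologicalType) (A : atlas R X)
    (s : section A) (p : X) :=
  exists2 i, dom i p & pole_at i (s i) p.

(* Equality of meromorphic sections, i.e. off a discrete set: a pointwise linear
   combination may have the wrong value where poles cancel. *)
Definition section_eq (R : realType) (X : topologicalType) (A : atlas R X)
    (s t : section A) :=
  forall i p, dom i p -> \forall q \near p^', s i q = t i q.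

Definition zero_section (R : realType) (X : topologicalType) (A : atlas R X) :
    section A := fun _ _ => 0.

Definition lincomb (R : realType) (X : topologicalType) (A : atlas R X) (r : nat)
    (c : 'I_r -> Cplx R) (s : 'I_r -> section A) : section A :=
  fun i p => \sum_(j < r) c j * s j i p.

Definition divisor (X : topologicalType) (D : X -> int) :=
  finite_set [set p | D p != 0].

Definition deg (X : topologicalType) (D : X -> int) : int :=
  \sum_(p \in [set: X]) D p.

Definition H0 (R : realType) (X : topologicalType) (A : atlas R X)
    (g : cocycle A) (D : X -> int) (s : section A) :=
  meromorphic_section g s /\
  (forall i p, dom i p -> ord_ge i (s i) p (- D p)).

Definition h0_vanishes (R : realType) (X : topologicalType) (A : atlas R X)
    (g : cocycle A) :=
  forall s, H0 g (fun=> 0) s -> section_eq s (@zero_section R X A).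

Definition H0_basis (R : realType) (X : topologicalType) (A : atlas R X)
    (g : cocycle A) (D : X -> int) (r : nat) (phi : 'I_r -> section A) :=
  [/\ forall j, H0 g D (phi j),
      forall c, section_eq (lincomb c phi) (@zero_section R X A) ->
        forall j, c j = 0
    & forall s, H0 g D s -> exists c, section_eq s (lincomb c phi)].

(* CP^1 is option C, with None the point at infinity. *)

Definition finite_part (R : realType) (X : topologicalType)
    (Z : X -> option (Cplx R)) : X -> Cplx R :=
  fun p => if Z p is Some z then z else 0.

Definition inverse_part (R : realType) (X : topologicalType)
    (Z : X -> option (Cplx R)) : X -> Cplx R :=
  fun p => if Z p is Some z then z^-1 else 0.

Definition meromorphic_map (R : realType) (X : topologicalType) (A : atlas R X)
    (Z : X -> option (Cplx R)) :=
  forall (i : chart A) p, dom i p ->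
    if Z p is Some _ then regular_at i (finite_part Z) p
    else pole_at i (finite_part Z) p.

Definition polar_divisor (R : realType) (X : topologicalType) (A : atlas R X)
    (Z : X -> option (Cplx R)) (Xi : X -> int) :=
  divisor Xi /\
  forall p, if Z p is Some _ then Xi p = 0
            else 0 < Xi p /\
              forall i : chart A, dom i p -> ord_eq i (finite_part Z) p (- Xi p).

(* dZ(p) = 0, in the coordinate 1/Z of CP^1 when Z(p) is infinite. *)
Definition ramification_point (R : realType) (X : topologicalType)
    (A : atlas R X) (Z : X -> option (Cplx R)) (p : X) :=
  exists2 i : chart A, dom i p &
    derive1 ((if Z p is Some _ then finite_part Z else inverse_part Z) \o param i)
      (coord i p) = 0.

Definition critical_value (R : realType) (X : topologicalType)
    (A : atlas R X) (Z : X -> option (Cplx R)) (v : option (Cplx R)) :=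
  exists2 p, ramification_point A Z p & Z p = v.

(* sh z a is the point z^(a). Any labelling of the fibres is allowed, in
   particular the one coming from a dissection of the z-plane. *)
Definition sheets (R : realType) (X : topologicalType) (A : atlas R X)
    (Z : X -> option (Cplx R)) (r : nat) (sh : Cplx R -> 'I_r -> X) :=
  forall z, ~ critical_value A Z (Some z) ->
    set_bij [set: 'I_r] [set p | Z p = Some z] (sh z).

(* tr p is the chart whose trivialization identifies the fibre over p with C. *)
Definition det_sections (R : realType) (X : topologicalType) (A : atlas R X)
    (tr : X -> chart A) (r : nat) (sh : Cplx R -> 'I_r -> X)
    (s : 'I_r -> section A) (z : Cplx R) : Cplx R :=
  \det (\matrix_(j < r, a < r) s j (tr (sh z a)) (sh z a)).

(* For coprime P and Q: the rational function P/Q has no pole at v. *)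
Definition no_pole (R : realType) (P Q : {poly Cplx R}) (v : option (Cplx R)) :=
  if v is Some z then Q.[z] != 0 else (size P <= size Q)%N.

(* Main.v *)
Require Import Defs.
From mathcomp Require Import ring.
Import Order.TTheory GRing.Theory Num.Theory.
Local Open Scope classical_set_scope.
Local Open Scope ring_scope.
Set Implicit Arguments.
Unset Strict Implicit.
Unset Printing Implicit Defensive.

(** Write L for the bundle X ⊗ √K and f for the function Z. The basis phi is a
    frame of the direct image of L(Xi) over the whole sphere, critical values
    included, and this only uses h^0(L) = 0. If det Phi vanished at a
    noncritical z0, some nonzero combination of the phi_k would vanish on the
    fibre over z0, and its quotient by f - z0 would be a nonzero holomorphic
    section of L. Given a section s of L(N Xi), subtract the combination of the
    phi_k that agrees with s on the fibre over z0 and divide by f - z0: the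
    result is a section of L((N - 1) Xi), so by induction s is the sum of
    M_k(f) phi_k with polynomials M_k of degree < N. A meromorphic section psi_j
    becomes such an s after multiplication by a polynomial q_j(f) whose roots
    are values of Z at poles of psi_j, hence
    det Psi = det M / (q_1 ... q_r) * det Phi, whatever the ramification. *)

(** * Convergent power series *)

Section PowerSeries.
Variable R : realType.
Local Notation K := (Cplx R).
Implicit Types (a b : nat -> K) (t : K) (C : K) (h : K -> K).

(** The order of the complex numbers is partial: [0 < e] forces [e] to be real, which brings in the
    Archimedean property of [R]. *)
Lemma half_expn_lt (e : K) : 0 < e ->
  exists N : nat, forall n, (N <= n)%N -> 2 ^- n < e.
Proof.
case: e => x y; rewrite ltcE /= => /andP[/eqP y0 x0].
exists (Num.Def.archi_bound x^-1) => n Nn.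
have -> : Complex x y = x%:C%C :> R[i] by apply/eqP; rewrite eq_complex /= y0 !eqxx.
have -> : (2 ^- n : K) = (2 ^- n)%:C%C.
  by rewrite (fmorphV (real_complex R)) rmorphXn /= rmorph_nat.
by rewrite ltcR; apply: realalg.RealAlg.upper_nthrootVP.
Qed.

Lemma natr_le_expn2 (n : nat) : n.+1%:R <= 2 ^+ n :> K.
Proof. by rewrite -natrX ler_nat ltn_expl. Qed.

Lemma sum_half_expn_le m n : \sum_(m <= k < n) 2 ^- k <= 2 * 2 ^- m :> K.
Proof.
suff H k : \sum_(m <= i < m + k) 2 ^- i = 2 * 2 ^- m - 2 * 2 ^- (m + k) :> K.
  have [nm|mn] := leqP n m.
    by rewrite big_geq // mulr_ge0 // invr_ge0 exprn_ge0.
  rewrite -(subnKC (ltnW mn)) H lerBlDr lerDl.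
  by rewrite mulr_ge0 // invr_ge0 exprn_ge0.
elim: k => [|k IH]; first by rewrite addn0 big_geq // subrr.
rewrite addnS big_nat_recr ?leq_addr //= IH exprS invfM.
by field; rewrite !expf_neq0 ?pnatr_eq0.
Qed.

Definition converges_to a t (l : K) :=
  series (fun k => a k * t ^+ k) @ \oo --> l.

(** Convergence at one nonzero [t] bounds the terms. A single constant absorbs both this bound and
    [1/|t|]; the exponent [k.+1] makes it cover [k = 0] as well. *)
Lemma coef_bound a t l : t != 0 -> converges_to a t l ->
  exists2 C : K, 0 < C & forall k, `|a k| <= C ^+ k.+1.
Proof.
move=> t0 cv.
have /cvgP/cvg_seq_bounded[M [Mr HM]] := cvg_series_cvg_0 (cvgP _ cv).
have HM1 : M < `|M| + 1 by rewrite (le_lt_trans (real_ler_norm Mr)) // ltrDl.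
have {HM1}HM k : `|a k * t ^+ k| <= `|M| + 1 by exact: HM.
exists (`|M| + 1 + `|t|^-1) => [|k].
  by rewrite ltr_wpDr ?invr_ge0 // ltr_wpDl.
rewrite exprS -(mulfK (expf_neq0 k t0) (a k)) normrM.
apply: ler_pM => //; first by rewrite (le_trans (HM k)) // lerDl invr_ge0.
by rewrite normfV normrX -exprVn lerXn2r ?nnegrE ?invr_ge0 ?addr_ge0 // lerDr addr_ge0.
Qed.

Lemma converges_to_at0 a : converges_to a 0 (a 0%N).
Proof.
apply: (@cvg_trans _ ((fun=> a 0%N) @ \oo)); last exact: cvg_cst.
apply: near_eq_cvg; near=> n.
have n0 : (0 < n)%N by near: n; exact: nbhs_infty_gt.
rewrite /series /= big_ltn // expr0 mulr1 big_nat big1 ?addr0 // => k /andP[k0 _].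
by rewrite expr0n gtn_eqF // mulr0.
Unshelve. all: by end_near. Qed.

Lemma convergesD a b t l m : converges_to a t l -> converges_to b t m ->
  converges_to (fun k => a k + b k) t (l + m).
Proof.
move=> ca cb; apply: (@cvg_trans _ ((series (fun k => a k * t ^+ k) \+
   series (fun k => b k * t ^+ k)) @ \oo)); last exact: (cvgD ca cb).
apply: near_eq_cvg; near=> n; rewrite /series /= -big_split /=.
by apply: eq_bigr => k _; rewrite mulrDl.
Unshelve. all: by end_near. Qed.

Lemma converges_cst (c : K) t : converges_to (fun k => if k == 0%N then c else 0) t c.
Proof.
apply: (@cvg_trans _ ((fun=> c) @ \oo)); last exact: cvg_cst.
apply: near_eq_cvg; near=> n.
have n0 : (0 < n)%N by near: n; exact: nbhs_infty_gt.
rewrite /series /= big_ltn // eqxx expr0 mulr1 big_nat big1 ?addr0 // => k /andP[k0 _].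
by rewrite gtn_eqF // mul0r.
Unshelve. all: by end_near. Qed.

Lemma converges_shift m a t l : t != 0 -> (forall k, (k < m)%N -> a k = 0) ->
  converges_to a t l -> converges_to (fun k => a (k + m)%N) t (l / t ^+ m).
Proof.
move=> t0 a0; rewrite /converges_to -(cvg_shiftn m) => ca.
apply: (@cvg_trans _ ((fun n => series (fun k => a k * t ^+ k) (n + m)%N / t ^+ m) @ \oo)).
  apply: near_eq_cvg; near=> n; rewrite /series /= (big_cat_nat (n := m)) ?leq_addl //=.
  rewrite big_nat big1 ?add0r; last by move=> k /andP[_ km]; rewrite a0 ?mul0r.
  rewrite -{1}(add0n m) big_addn addnK mulr_suml; apply: eq_bigr => k _.
  by rewrite exprD mulrA mulfK // expf_neq0.
by apply: cvgMl.
Unshelve. all: by end_near. Qed.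

Definition cauchy_coef a b k : K := \sum_(i < k.+1) a i * b (k - i)%N.

(* Truncating both series makes the difference a tail of a product of two
   polynomials, whose k-th term is at most (k + 1) C^2 4^-k <= C^2 2^-k. *)
Lemma cauchy_product_bound a b C t n :
  0 < C -> (forall k, `|a k| <= C ^+ k.+1) -> (forall k, `|b k| <= C ^+ k.+1) ->
  `|t| * C <= 4^-1 ->
  `|series (fun k => cauchy_coef a b k * t ^+ k) n -
    series (fun k => a k * t ^+ k) n * series (fun k => b k * t ^+ k) n|
  <= C ^+ 2 * (2 * 2 ^- n).
Proof.
move=> C0 aC bC tC.
pose p := \poly_(i < n) a i; pose q := \poly_(i < n) b i.
have evp c : series (fun k => c k * t ^+ k) n = (\poly_(i < n) c i).[t].
  by rewrite /series /= horner_poly big_mkord.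
have coef_pq k : (k < n)%N -> (p * q)`_k = cauchy_coef a b k.
  move=> kn; rewrite coefM; apply: eq_bigr => i _.
  rewrite !coef_poly (leq_ltn_trans _ kn) ?(leq_ltn_trans _ kn) ?leq_subr //.
  by rewrite -ltnS.
have pq_le k : `|(p * q)`_k * t ^+ k| <= C ^+ 2 * 2 ^- k.
  have -> : C ^+ 2 * 2 ^- k = C ^+ 2 * 2 ^+ k * (4 ^- k).
    rewrite -mulrA; congr (_ * _); rewrite (_ : 4 = 2 * 2) ?exprMn; last by rewrite -natrM.
    by field; rewrite !expf_neq0 ?pnatr_eq0.
  rewrite normrM.
  have h1 : `|(p * q)`_k| <= k.+1%:R * C ^+ k.+2.
    rewrite coefM (le_trans (ler_norm_sum _ _ _)) // -[X in X%:R * _]card_ord.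
    rewrite mulr_natl -sumr_const; apply: ler_sum => i _.
    have coef_le c m : (forall k, `|c k| <= C ^+ k.+1) ->
        `|(\poly_(i < n) c i)`_m| <= C ^+ m.+1.
      by move=> cC; rewrite coef_poly; case: ifP => // _; rewrite normr0 exprn_ge0 ?ltW.
    rewrite normrM (_ : k.+2 = i.+1 + (k - i).+1)%N ?exprD; last first.
      by rewrite addnS addSn subnKC // -ltnS.
    by rewrite ler_pM ?coef_le.
  have h2 : k.+1%:R * C ^+ k.+2 * `|t ^+ k| <= 2 ^+ k * C ^+ 2 * (`|t| * C) ^+ k.
    rewrite normrX exprMn [C ^+ k.+2]exprSr [C ^+ k.+1]exprSr.
    have -> : k.+1%:R * (C ^+ k * C * C) * `|t| ^+ k =
       k.+1%:R * C ^+ 2 * (`|t| ^+ k * C ^+ k) by ring.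
    have e0 : 0 <= `|t| ^+ k * C ^+ k by rewrite mulr_ge0 // exprn_ge0 // ltW.
    rewrite ler_wpM2r //.
    by rewrite ler_wpM2r ?natr_le_expn2 // mulr_ge0 // ltW.
  apply: le_trans (ler_wpM2r (normr_ge0 _) h1) _; apply: le_trans h2 _.
  rewrite [2 ^+ k * _]mulrC; apply: ler_wpM2l.
    by rewrite mulr_ge0 ?exprn_ge0 //; exact: ltW.
  by rewrite -exprVn lerXn2r ?nnegrE ?mulr_ge0 ?invr_ge0 //; exact: ltW.
rewrite !evp -hornerM -/p -/q distrC.
have sz : (size (p * q)%R <= n + n)%N.
  apply: leq_trans (size_polyMleq _ _) _.
  by rewrite (leq_trans (leq_pred _)) // leq_add ?size_poly.
rewrite (horner_coef_wide _ sz) -evp /series /= -(big_mkord xpredT (fun i => (p * q)`_i * t ^+ i)).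
rewrite (big_cat_nat (n := n)) ?leq_addr //=.
rewrite (eq_big_nat _ _ (F2 := fun k => cauchy_coef a b k * t ^+ k)); last first.
  by move=> k /andP[_ kn]; rewrite coef_pq.
rewrite addrAC subrr add0r (le_trans (ler_norm_sum _ _ _)) //.
rewrite (le_trans (ler_sum _ (fun k _ => pq_le k))) // -mulr_sumr.
by apply: ler_wpM2l (sum_half_expn_le _ _); rewrite exprn_ge0 // ltW.
Qed.

Lemma cauchy_product_cvg a b C t :
  0 < C -> (forall k, `|a k| <= C ^+ k.+1) -> (forall k, `|b k| <= C ^+ k.+1) ->
  `|t| * C <= 4^-1 ->
  (fun n => series (fun k => cauchy_coef a b k * t ^+ k) n -
    series (fun k => a k * t ^+ k) n * series (fun k => b k * t ^+ k) n) @ \oo --> (0 : K).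
Proof.
move=> C0 aC bC tC; apply/cvgrPdist_lt => e e0.
have D0 : 0 < C ^+ 2 * 2 by rewrite mulr_gt0 // exprn_gt0.
have [N HN] := half_expn_lt (divr_gt0 e0 D0).
near=> n; rewrite sub0r normrN.
apply: le_lt_trans (cauchy_product_bound n C0 aC bC tC) _.
rewrite mulrA -ltr_pdivlMl // mulrC HN //.
by near: n; exact: nbhs_infty_ge.
Unshelve. all: by end_near. Qed.

End PowerSeries.

(** * Reciprocal of a power series *)

Section Inverse.
Variable R : realType.
Local Notation K := (Cplx R).
Implicit Types (a b : nat -> K) (t : K) (C : K) (h : K -> K).

(** Each coefficient of the reciprocal depends on all the earlier ones, so the recursion carries the
    list of them. *)
Fixpoint inverse_coefs a n : seq K :=
  if n is m.+1 then
    let s := inverse_coefs a m in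
    rcons s (if m == 0%N then (a 0%N)^-1
             else - (a 0%N)^-1 * \sum_(j < m) a (m - j)%N * s`_j)
  else [::].

Definition inverse_coef a n : K := (inverse_coefs a n.+1)`_n.

Lemma size_inverse_coefs a n : size (inverse_coefs a n) = n.
Proof. by elim: n => //= n IH; rewrite size_rcons IH. Qed.

Lemma nth_inverse_coefs a n j : (j < n)%N ->
  (inverse_coefs a n)`_j = inverse_coef a j.
Proof.
elim: n => // n IH; rewrite ltnS leq_eqVlt => /predU1P[-> //|jn].
by rewrite /= nth_rcons size_inverse_coefs jn IH.
Qed.

Lemma inverse_coefE a n : (0 < n)%N -> inverse_coef a n =
  - (a 0%N)^-1 * \sum_(j < n) a (n - j)%N * inverse_coef a j.
Proof.
move=> n0; rewrite /inverse_coef /= nth_rcons size_inverse_coefs ltnn eqxx.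
rewrite gtn_eqF //; congr (_ * _); apply: eq_bigr => j _.
by rewrite nth_inverse_coefs.
Qed.

Lemma cauchy_inverse_coef a k : a 0%N != 0 ->
  cauchy_coef (inverse_coef a) a k = if k == 0%N then 1 else 0.
Proof.
move=> a0; case: k => [|k].
  by rewrite /cauchy_coef big_ord_recl big_ord0 addr0 subnn /= mulVf.
rewrite /cauchy_coef big_ord_recr /= subnn inverse_coefE // mulrAC.
rewrite mulNr mulVf // mulN1r; apply/eqP; rewrite subr_eq0; apply/eqP.
by apply: eq_bigr => i _; rewrite mulrC.
Qed.

(** A majorant argument: from [|a k| <= |a 0| E^k] for [k > 0], the recursion gives
    [|b k| <= (2 E)^k / |a 0|]. Taking [D] above [C] lets one constant bound both series in the
    Cauchy product. *)
Lemma inverse_coef_bound a C : a 0%N != 0 -> 0 < C ->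
  (forall k, `|a k| <= C ^+ k.+1) ->
  exists2 D : K, C <= D & forall k, `|inverse_coef a k| <= D ^+ k.+1.
Proof.
move=> a0 C0 aC; have na0 : 0 < `|a 0%N| by rewrite normr_gt0.
(* Chosen so that [C^(k+1) = |a 0| C^k (C / |a 0|) <= |a 0| E^k] for [k > 0]. *)
pose E : K := C * (1 + C / `|a 0%N|).
have CA0 : 0 < C / `|a 0%N| by rewrite divr_gt0.
have E0 : 0 < E by rewrite mulr_gt0 // ltr_wpDl.
have aE k : (0 < k)%N -> `|a k| <= `|a 0%N| * E ^+ k.
  move=> k0; apply: le_trans (aC k) _.
  have -> : C ^+ k.+1 = `|a 0%N| * (C ^+ k * (C / `|a 0%N|)).
    by rewrite exprSr; field; rewrite gt_eqF.
  rewrite ler_wpM2l // /E exprMn ler_wpM2l ?exprn_ge0 //; first exact: ltW.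
  case: k k0 => // k _; rewrite exprSr -[X in X <= _]mul1r.
  apply: ler_pM => //; first exact: ltW.
    by apply: exprn_ege1; rewrite lerDl ltW.
  by rewrite lerDr.
have bE k : `|inverse_coef a k| <= `|a 0%N|^-1 * (E ^+ k * 2 ^+ k).
  have [n] := ubnP k; elim: n k => // n IH [|k] kn.
    by rewrite /inverse_coef /= expr0 !mulr1 normfV.
  rewrite inverse_coefE // mulNr normrN normrM normfV ler_wpM2l ?invr_ge0 //.
  apply: le_trans (ler_norm_sum _ _ _) _.
  have -> : E ^+ k.+1 * 2 ^+ k.+1 = E ^+ k.+1 * (1 + \sum_(j < k.+1) 2 ^+ j).
    by congr (_ * _); elim: {kn}k.+1 => [|m IHm];
      rewrite ?big_ord0 ?addr0 // big_ord_recr addrA -IHm /= exprS; ring.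
  apply: (@le_trans _ _ (E ^+ k.+1 * \sum_(j < k.+1) 2 ^+ j)); last first.
    by rewrite ler_wpM2l ?exprn_ge0 ?lerDr //; exact: ltW.
  rewrite mulr_sumr; apply: ler_sum => j _; rewrite normrM.
  have jk : (j < k.+1)%N := ltn_ord j.
  apply: (@le_trans _ _ ((`|a 0%N| * E ^+ (k.+1 - j)) *
      (`|a 0%N|^-1 * (E ^+ j * 2 ^+ j)))).
    apply: ler_pM => //; first by rewrite aE // subn_gt0.
    by rewrite IH // (leq_trans jk).
  have -> : E ^+ k.+1 = E ^+ (k.+1 - j) * E ^+ j.
    by rewrite -exprD subnK // ltnW.
  rewrite le_eqVlt; apply/orP; left; apply/eqP.
  by field; rewrite gt_eqF.
have E2 : 0 <= E * 2 by rewrite mulr_ge0 // ltW.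
have i0 : 0 <= `|a 0%N|^-1 by rewrite invr_ge0.
exists (C + (`|a 0%N|^-1 + E * 2)) => [|k]; first by rewrite lerDl addr_ge0.
apply: le_trans (bE k) _; rewrite exprS -exprMn.
apply: ler_pM => //; first by rewrite exprn_ge0.
  by rewrite addrCA lerDl addr_ge0 // ltW.
apply: lerXn2r; rewrite ?nnegrE ?addr_ge0 //; first exact: ltW.
by rewrite addrA lerDr addr_ge0 // ltW.
Qed.

End Inverse.

(** * Local theory of analytic functions *)

Section Analytic.
Variable R : realType.
Local Notation K := (Cplx R).
Implicit Types (a b : nat -> K) (z t : K) (C : K) (h : K -> K).

Lemma eq_converges a b t l : a =1 b -> converges_to a t l -> converges_to b t l.
Proof. by move=> /funext->. Qed.

Lemma near_small z (e : K) : 0 < e -> \forall w \near z, `|w - z| < e.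
Proof.
move=> e0; apply/nbhs_ballP; exists e => //= w.
by rewrite -ball_normE /= distrC.
Qed.

(** The factorization of [t^k - t'^k] and the bound [1/(4C)] on both points make the k-th term at
    most [2 C^2 |t - t'| 2^-k]. The resulting constant is independent of [n]. *)
Lemma series_lipschitz a C t t' n : 0 < C ->
  (forall k, `|a k| <= C ^+ k.+1) -> `|t| * C <= 4^-1 -> `|t'| * C <= 4^-1 ->
  `|series (fun k => a k * t ^+ k) n - series (fun k => a k * t' ^+ k) n|
  <= C ^+ 2 * 4 * `|t - t'|.
Proof.
move=> C0 aC tC tC'.
have le_d (s : K) : `|s| * C <= 4^-1 -> `|s| <= (4 * C)^-1.
  by rewrite invfM -ler_pdivlMr.
have d0 : 0 <= (4 * C)^-1 by rewrite invr_ge0 mulr_ge0 // ltW.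
have term k : `|a k * t ^+ k - a k * t' ^+ k| <=
    (C ^+ 2 * 2 * `|t - t'|) * 2 ^- k.
  rewrite -mulrBr subrXX !normrM.
  case: k => [|k].
    rewrite big_ord0 normr0 !mulr0 mulr_ge0 ?invr_ge0 ?exprn_ge0 //.
    by rewrite !mulr_ge0 ?exprn_ge0 // ltW.
  have h1 : `|\sum_(i < k.+1) t ^+ (k.+1.-1 - i) * t' ^+ i| <=
      k.+1%:R * (4 * C) ^- k.
    apply: le_trans (ler_norm_sum _ _ _) _.
    rewrite -[X in X%:R * _]card_ord mulr_natl -sumr_const.
    apply: ler_sum => i _ /=.
    have -> : (4 * C) ^- k = (4 * C)^-1 ^+ (k - i) * (4 * C)^-1 ^+ i.
      by rewrite -exprD subnK ?exprVn // -ltnS.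
    by rewrite normrM !normrX; apply: ler_pM;
      rewrite ?exprn_ge0 //; apply: lerXn2r; rewrite ?nnegrE // le_d.
  have h2 : k.+1%:R * (4 * C) ^- k <= 2 ^+ k * (4 * C) ^- k.
    apply: ler_wpM2r (natr_le_expn2 R k).
    by rewrite -exprVn exprn_ge0.
  apply: (@le_trans _ _ (C ^+ k.+2 * (`|t - t'| * (2 ^+ k * (4 * C) ^- k)))).
    apply: ler_pM => //; apply: ler_wpM2l => //.
    exact: le_trans h1 h2.
  rewrite le_eqVlt; apply/orP; left; apply/eqP.
  have -> : 4 = 2 * 2 :> K by rewrite -natrM.
  rewrite !exprMn !exprS; field.
  by rewrite !expf_neq0 ?pnatr_eq0 // gt_eqF.
rewrite /series /= -sumrB (le_trans (ler_norm_sum _ _ _)) //.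
rewrite (le_trans (ler_sum _ (fun k _ => term k))) // -mulr_sumr.
have -> : C ^+ 2 * 4 * `|t - t'| = C ^+ 2 * 2 * `|t - t'| * (2 * 2 ^- 0).
  by rewrite expr0; field.
by apply: ler_wpM2l (sum_half_expn_le _ _ _); rewrite !mulr_ge0 ?exprn_ge0 // ltW.
Qed.

(** The growth bound comes from convergence at the single point [z + e / 2] inside the disc of
    radius [e]. *)
Lemma analytic_coefs h z : analytic_at h z -> exists a, exists C : K,
  [/\ 0 < C, forall k, `|a k| <= C ^+ k.+1 &
      \forall w \near z, converges_to a (w - z) (h w)].
Proof.
move=> [a ha]; exists a.
have /nbhs_ballP[e /= e0 he] := ha.
have e20 : 0 < e / 2 by rewrite divr_gt0.
have : converges_to a (z + e / 2 - z) (h (z + e / 2)).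
  apply: he; rewrite -ball_normE /= opprD addNKr normrN gtr0_norm //.
  by rewrite ltr_pdivrMr // ltr_pMr // ltr1n.
move=> /coef_bound[|C C0 aC]; first by rewrite addrAC subrr add0r gt_eqF.
by exists C.
Qed.

Lemma near_mul_le z C (e : K) : 0 < C -> 0 < e ->
  \forall w \near z, `|w - z| * C <= e.
Proof.
move=> C0 e0; near=> w; rewrite -ler_pdivlMr // ltW //.
by near: w; apply: near_small; rewrite divr_gt0.
Unshelve. all: by end_near. Qed.

(** An [e / 3] argument in which the truncation order [n] may depend on both points, since the
    Lipschitz bound is uniform in [n]. Continuity in a whole neighbourhood is what later isolates
    poles. *)
Lemma analytic_continuous h z : analytic_at h z ->
  \forall w \near z, {for w, continuous h}.
Proof.
move=> /analytic_coefs[a [C [C0 aC ha]]].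
have q0 : (0 : K) < 4^-1 by rewrite invr_gt0.
have hz : \forall w \near z, converges_to a (w - z) (h w) /\ `|w - z| * C <= 4^-1.
  by near=> w; split; near: w => //; exact: near_mul_le.
have hz2 := near_join hz.
near=> w.
have hw : \forall w' \near w, converges_to a (w' - z) (h w') /\ `|w' - z| * C <= 4^-1.
  by near: w; exact: hz2.
have [cw sw] := nbhs_singleton hw.
apply/(@cvgrPdist_lt _ _ _ (nbhs w) (nbhs_filter w) h (h w)) => e e0.
have L0 : 0 < C ^+ 2 * 4 by rewrite mulr_gt0 // exprn_gt0.
have e30 : 0 < e / 3 by rewrite divr_gt0.
near=> w'.
have [cw' sw'] : converges_to a (w' - z) (h w') /\ `|w' - z| * C <= 4^-1.
  by near: w'.
move/cvgrPdist_lt/(_ _ e30) : cw => cw; move/cvgrPdist_lt/(_ _ e30) : cw' => cw'.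
have [n [n1 n2]] := filter_ex (filterI cw cw').
set Sw := series _ n in n1; set Sw' := series _ n in n2.
have {}n2 : `|Sw' - h w'| < e / 3 by rewrite distrC.
suff n3 : `|Sw - Sw'| < e / 3.
  have -> : h w - h w' = (h w - Sw) + (Sw - Sw') + (Sw' - h w') by ring.
  have -> : e = e / 3 + e / 3 + e / 3 by field.
  apply: le_lt_trans (ler_normD _ _) (ltrD _ n2).
  exact: le_lt_trans (ler_normD _ _) (ltrD n1 n3).
apply: le_lt_trans (series_lipschitz n C0 aC sw sw') _.
have -> : w - z - (w' - z) = w - w' by ring.
rewrite mulrC -ltr_pdivlMr // distrC.
by near: w'; apply: near_small; rewrite divr_gt0.
Unshelve. all: by end_near. Qed.

Lemma analytic_continuous_at h z : analytic_at h z -> {for z, continuous h}.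
Proof. by move=> /analytic_continuous /nbhs_singleton. Qed.

Lemma converges_unique a t (l m : K) : converges_to a t l -> converges_to a t m -> l = m.
Proof. by move=> cl cm; apply: (cvg_unique _ cl cm); exact: norm_hausdorff. Qed.

Lemma analytic_value a h z : (\forall w \near z, converges_to a (w - z) (h w)) ->
  h z = a 0%N.
Proof.
move=> /nbhs_singleton; rewrite subrr => cz.
exact: converges_unique cz (@converges_to_at0 _ a).
Qed.

Lemma analytic_cst (c : K) z : analytic_at (fun=> c) z.
Proof.
exists (fun k => if k == 0%N then c else 0).
by near=> w; exact: converges_cst.
Unshelve. all: by end_near. Qed.

Lemma analyticD h h' z : analytic_at h z -> analytic_at h' z ->
  analytic_at (fun w => h w + h' w) z.
Proof.
move=> [a ha] [b hb]; exists (fun k => a k + b k).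
apply: filterS2 ha hb => w ca cb; exact: (convergesD ca cb).
Qed.

Lemma analyticM h h' z : analytic_at h z -> analytic_at h' z ->
  analytic_at (fun w => h w * h' w) z.
Proof.
move=> /analytic_coefs[a [C [C0 aC ha]]] /analytic_coefs[b [D [D0 bD hb]]].
have CD0 : 0 < C + D by rewrite addr_gt0.
have aCD k : `|a k| <= (C + D) ^+ k.+1.
  by rewrite (le_trans (aC k)) // lerXn2r ?nnegrE ?ltW // ltrDl.
have bCD k : `|b k| <= (C + D) ^+ k.+1.
  by rewrite (le_trans (bD k)) // lerXn2r ?nnegrE ?ltW // ltrDr.
have q0 : (0 : K) < 4^-1 by rewrite invr_gt0.
exists (cauchy_coef a b).
apply: filterS3 ha hb (near_mul_le z CD0 q0) => w ca cb wC.
have := cvgD (cauchy_product_cvg CD0 aCD bCD wC) (cvgM ca cb); rewrite add0r => /(_ _ _) cab.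
refine (cvg_trans (near_eq_cvg _) cab); near=> n.
by rewrite /= subrK.
Unshelve. all: by end_near. Qed.

(** With [A_n] and [B_n] the partial sums of [h] and of the formal reciprocal, [B_n A_n] tends to 1
    by the Cauchy product and [A_n] to [h w != 0]; dividing yields the convergence of [B_n]. *)
Lemma analyticV h z : h z != 0 -> analytic_at h z ->
  analytic_at (fun w => (h w)^-1) z.
Proof.
move=> hz0 han; have hcont := analytic_continuous_at han.
have /analytic_coefs[a [C [C0 aC ha]]] := han.
have a0 : a 0%N != 0 by rewrite -(analytic_value ha).
have [D CD bD] := inverse_coef_bound a0 C0 aC.
have D0 := lt_le_trans C0 CD.
have aD k : `|a k| <= D ^+ k.+1.
  by rewrite (le_trans (aC k)) // lerXn2r ?nnegrE // ltW.
have q0 : (0 : K) < 4^-1 by rewrite invr_gt0.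
have hn0 : \forall w \near z, h w != 0.
  exact: (cvgr_neq0 _ hcont hz0).
exists (inverse_coef a).
apply: filterS3 ha hn0 (near_mul_le z D0 q0) => w ca hw0 wD.
have cc : converges_to (cauchy_coef (inverse_coef a) a) (w - z) 1.
  apply: eq_converges (@converges_cst R 1 (w - z)) => k.
  by rewrite cauchy_inverse_coef.
have := cvgB cc (cauchy_product_cvg D0 bD aD wD); rewrite subr0 => /(_ _) cBA.
have := cvgM cBA (cvgV hw0 ca); rewrite mul1r => /(_ _ _) cB.
refine (cvg_trans (near_eq_cvg _) cB); near=> n.
rewrite /= opprB addrC subrK mulfK //.
by near: n; exact: (cvgr_neq0 _ ca hw0).
Unshelve. all: by end_near. Qed.

Lemma analytic_coord z0 z : analytic_at (fun w => w - z0) z.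
Proof.
have -> : (fun w => w - z0) = (fun w => (w - z) + (z - z0)).
  by apply/funext => w; rewrite addrA subrK.
apply: analyticD; last exact: analytic_cst.
exists (fun k => if k == 1%N then 1 else 0); near=> w.
rewrite -(cvg_shiftn 2); apply: (@cvg_trans _ ((fun=> w - z) @ \oo)).
  apply: near_eq_cvg; near=> n; rewrite /series /= addn2.
  rewrite big_ltn // mul0r add0r big_ltn // eqxx mul1r expr1 big_nat.
  by rewrite big1 ?addr0 // => k /andP[k1 _]; rewrite gtn_eqF // mul0r.
exact: cvg_cst.
Unshelve. all: by end_near. Qed.

Lemma analyticX h z n : analytic_at h z -> analytic_at (fun w => h w ^+ n) z.
Proof.
move=> hz; elim: n => [|n IH]; first exact: analytic_cst.
by under eq_fun do rewrite exprS; exact: analyticM.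
Qed.

(** The exponent is the index of the first nonzero coefficient; if there is none, the germ is
    zero. *)
Lemma analytic_factor h z : analytic_at h z ->
  (\forall w \near z, h w = 0) \/
  exists m : nat, exists2 h', analytic_at h' z /\ h' z != 0 &
    \forall w \near z, h w = (w - z) ^+ m * h' w.
Proof.
move=> [a aP]; have ha : \forall w \near z, converges_to a (w - z) (h w) by [].
have [a0|/existsNP[m0 /eqP am0]] := pselect (forall k, a k = 0).
  left; near=> w; have cw : converges_to a (w - z) (h w) by near: w.
  apply: converges_unique cw _; apply: eq_converges (@converges_cst R 0 (w - z)) => k.
  by rewrite a0 if_same.
right; have ex : exists m, a m != 0 by exists m0.
have [m am mmin] := ex_minnP ex.
have lt0 k : (k < m)%N -> a k = 0.
  by move=> km; apply/eqP; apply: contraTT km => ak; rewrite -leqNgt mmin.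
pose b k := a (k + m)%N; exists m.
(* At [z] the quotient would take the default value of division by zero when [m > 0]; the correct
   value is the leading coefficient. *)
pose h' w := if w == z then a m else h w / (w - z) ^+ m.
have h'z : h' z = a m by rewrite /h' eqxx.
exists h'; first (split; last by rewrite h'z).
- exists b; near=> w; rewrite /h'; case: eqVneq => [->|wz].
    by rewrite subrr -[a m]/(b 0%N); exact: converges_to_at0.
  have cw : converges_to a (w - z) (h w) by near: w.
    by apply: (converges_shift _ lt0 cw); rewrite subr_eq0.
- near=> w; rewrite /h'; case: eqVneq => [->|wz]; last first.
    by rewrite mulrC divfK // expf_neq0 // subr_eq0.
  rewrite subrr (analytic_value ha) expr0n; case: (m) lt0 => [|m'] lt0.
    by rewrite mul1r.
  by rewrite mul0r lt0.
Unshelve. all: by end_near. Qed.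

Lemma analytic_root h z : analytic_at h z -> h z = 0 ->
  exists2 h', analytic_at h' z & \forall w \near z, h w = (w - z) * h' w.
Proof.
move=> hz; have [h0 _|[[|m] [h' [ah' h'0] hh'] hz0]] := analytic_factor hz.
- exists (fun=> 0); first exact: analytic_cst.
  by apply: filterS h0 => w ->; rewrite mulr0.
- have := nbhs_singleton hh'; rewrite hz0 mul1r => /esym/eqP.
  by rewrite (negPf h'0).
- exists (fun w => (w - z) ^+ m * h' w).
    exact: (analyticM (analyticX m (analytic_coord z z)) ah').
  by apply: filterS hh' => w ->; rewrite exprS mulrA.
Qed.

End Analytic.

(** * Orders of germs on a surface *)

Section Germs.
Variables (R : realType) (X : topologicalType) (A : atlas R X).
Hypothesis hausX : hausdorff_space X.
Local Notation K := (Cplx R).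
Implicit Types (i j : chart A) (p q : X) (f : X -> K) (n : int).

Local Opaque analytic_at.

Lemma cvg_exprn {T : Type} {F : set_system T} {FF : Filter F} {f : T -> K} {l : K} m :
  f x @[x --> F] --> l -> f x ^+ m @[x --> F] --> l ^+ m.
Proof.
move=> fl; elim: m => [|m IH]; first exact: cvg_cst.
rewrite exprS (_ : (fun x => f x ^+ m.+1) = (fun x => f x * f x ^+ m)).
  exact: cvgM fl IH.
by apply/funext => x; rewrite exprS.
Qed.

Lemma near_dom i p : dom i p -> \forall q \near p, dom i q.
Proof. by move=> ip; apply: open_nbhs_nbhs; split => //; exact: dom_open. Qed.

Lemma near_coord i p (P : K -> Prop) : dom i p ->
  (\forall w \near coord i p, P w) -> \forall q \near p, P (coord i q).
Proof. by move=> /coord_cont ip; exact: ip. Qed.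

Lemma dnbhs_nbhs p (P : X -> Prop) :
  (\forall q \near p, P q) -> \forall q \near p^', P q.
Proof. by move=> hP; rewrite near_withinE; apply: filterS hP. Qed.

Lemma near_coord_sub0 i p : dom i p -> \forall q \near p^', coord i q - coord i p != 0.
Proof.
move=> ip; rewrite near_withinE; apply: filterS (near_dom ip) => q iq.
rewrite subr_eq0; apply: contra_neq => qp.
by rewrite -(coordK iq) qp coordK.
Qed.

Lemma cvg_coord i p : dom i p -> coord i q @[q --> p^'] --> coord i p.
Proof. by move=> /coord_cont ip; exact: cvg_within_filter ip. Qed.

Lemma cvg_coord_sub i p : dom i p -> coord i q - coord i p @[q --> p^'] --> (0 : K).
Proof. by move=> ip; rewrite -(subrr (coord i p)); apply: cvgB (cvg_coord ip) (cvg_cst _). Qed.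

Lemma near_param_coord i p : dom i p ->
  \forall w \near coord i p, coord i (param i w) = w.
Proof.
move=> ip; have : \forall w \near coord i p, (coord i @` dom i) w.
  by apply: open_nbhs_nbhs; split; [exact: coord_open | exists p].
by apply: filterS => _ [q iq <-]; rewrite coordK.
Qed.

Lemma near_param i p (P : X -> Prop) : dom i p -> (\forall q \near p, P q) ->
  \forall w \near coord i p, P (param i w).
Proof. by move=> ip hP; apply: (param_cont ip); rewrite coordK. Qed.

(** A chart carries [p] to a point of an open subset of the complex plane, so [p] is not isolated.
    Limits along [p^'] are therefore unique. *)
Lemma dnbhs_proper p : ProperFilter p^'.
Proof.
have [i ip] := dom_cover A p.
apply: Build_ProperFilter => hp.
have /(near_param ip) hw : \forall q \near p, q != p -> False by [].
have : \forall w \near (coord i p)^', False.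
  rewrite near_withinE; near=> w => wp.
  have : param i w != p -> False by near: w; exact: hw.
  apply; apply: contra_neq wp => <-; apply/esym.
  by near: w; exact: near_param_coord.
by move=> /filter_ex[].
Unshelve. all: by end_near. Qed.

#[local] Existing Instance dnbhs_proper.

Lemma near_neq p q : q != p -> \forall q' \near q, q' != p.
Proof.
move=> qp; have [B [oB qB pB]] := hausdorff_accessible hausX qp.
have : nbhs q B by apply: open_nbhs_nbhs; split => //; exact/set_mem.
apply: filterS => q' Bq'; apply/eqP => q'p.
by move/set_mem: pB; apply; rewrite -q'p.
Qed.

(** Since points are closed, a nearby [q != p] has a full neighbourhood avoiding [p]. This turns an
    expansion on a punctured neighbourhood of [p] into information around [q]. *)
Lemma dnbhs_join p (P : X -> Prop) : (\forall q \near p^', P q) ->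
  \forall q \near p^', \forall q' \near q, P q'.
Proof.
rewrite !near_withinE => /near_join hP; apply: filterS hP => q hq qp.
by apply: filterS2 hq (near_neq qp) => q'; apply.
Qed.

Lemma eq_near_cvg f f' p (l : K) : (\forall q \near p^', f q = f' q) ->
  f q @[q --> p^'] --> l -> f' q @[q --> p^'] --> l.
Proof. by move=> ff'; apply: cvg_trans; exact: near_eq_cvg. Qed.

Lemma cvg_dnbhs_unique f p (l m : K) :
  f q @[q --> p^'] --> l -> f q @[q --> p^'] --> m -> l = m.
Proof. by move=> fl fm; apply: (cvg_unique _ fl fm); exact: norm_hausdorff. Qed.

Lemma analytic_cvg h i p : dom i p -> analytic_at h (coord i p) ->
  h (coord i q) @[q --> p^'] --> h (coord i p).
Proof.
move=> ip /analytic_continuous_at hc.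
exact: (cvg_comp _ _ (cvg_coord ip) hc).
Qed.

Lemma analytic_comp_continuous h i p : dom i p -> {for coord i p, continuous (h : K -> K)} ->
  {for p, continuous ((h : K -> K) \o coord i)}.
Proof. by move=> ip hc; exact: (continuous_comp (coord_cont ip) hc). Qed.

Lemma eq_near_ord_ge f f' i p n : (\forall q \near p^', f q = f' q) ->
  ord_ge i f p n -> ord_ge i f' p n.
Proof.
move=> ff' [h [ah fh]]; exists h; split=> //.
by apply: filterS2 ff' fh => q <-.
Qed.

Lemma ord_eq_ge f i p n : ord_eq i f p n -> ord_ge i f p n.
Proof. by move=> [h ? _]; exists h. Qed.

Lemma ord_ge_le f i p n m : dom i p -> m <= n -> ord_ge i f p n -> ord_ge i f p m.
Proof.
move=> ip mn [h [ah fh]].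
have [k nk] : exists k : nat, n = m + k%:Z.
  by exists `|n - m|%N; rewrite gez0_abs ?subr_ge0 // addrCA subrr addr0.
exists (fun w => (w - coord i p) ^+ k * h w); split.
  exact: analyticM (analyticX k (analytic_coord _ _)) ah.
apply: filterS2 fh (near_coord_sub0 ip) => q -> q0.
by rewrite nk expfzDr // mulrA -exprnP.
Qed.

Lemma ord_geD f f' i p n : ord_ge i f p n -> ord_ge i f' p n ->
  ord_ge i (fun q => f q + f' q) p n.
Proof.
move=> [h [ah fh]] [h' [ah' fh']]; exists (fun w => h w + h' w); split.
  exact: analyticD ah ah'.
by apply: filterS2 fh fh' => q -> ->; rewrite mulrDr.
Qed.

Lemma ord_geM f f' i p n m : dom i p -> ord_ge i f p n -> ord_ge i f' p m ->
  ord_ge i (fun q => f q * f' q) p (n + m).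
Proof.
move=> ip [h [ah fh]] [h' [ah' fh']]; exists (fun w => h w * h' w); split.
  exact: analyticM ah ah'.
apply: filterS3 fh fh' (near_coord_sub0 ip) => q -> -> q0.
by rewrite expfzDr // mulrACA.
Qed.

Lemma ord_ge_cst (c : K) i p : ord_ge i (fun=> c) p 0.
Proof.
exists (fun=> c); split; first exact: analytic_cst.
by apply: filterE => q; rewrite expr0z mul1r.
Qed.

Lemma ord_geZ (c : K) f i p n : dom i p -> ord_ge i f p n ->
  ord_ge i (fun q => c * f q) p n.
Proof. by move=> ip hf; rewrite -[n]add0r; exact: ord_geM ip (ord_ge_cst c i p) hf. Qed.

Lemma ord_ge0 i p n : ord_ge i (fun=> 0) p n.
Proof.
exists (fun=> 0); split; first exact: analytic_cst.
by apply: filterE => q; rewrite mulr0.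
Qed.

Lemma ord_ge_sum (I : Type) (r : seq I) (F : I -> X -> K) i p n :
  (forall k, ord_ge i (F k) p n) -> ord_ge i (fun q => \sum_(k <- r) F k q) p n.
Proof.
move=> hF; elim: r => [|k r IH].
  by under eq_fun do rewrite big_nil; exact: ord_ge0.
by under eq_fun do rewrite big_cons; exact: ord_geD.
Qed.

Lemma ord_geX f i p n k : dom i p -> ord_ge i f p n ->
  ord_ge i (fun q => f q ^+ k) p (n *+ k).
Proof.
move=> ip hf; elim: k => [|k IH].
  by rewrite mulr0n; under eq_fun do rewrite expr0; exact: ord_ge_cst.
by rewrite mulrS; under eq_fun do rewrite exprS; exact: ord_geM.
Qed.

Lemma ord_geV f i p n : dom i p -> ord_eq i f p n ->
  ord_ge i (fun q => (f q)^-1) p (- n).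
Proof.
move=> ip [h [ah fh] h0]; exists (fun w => (h w)^-1); split.
  exact: analyticV h0 ah.
by apply: filterS fh => q ->; rewrite invfM invr_expz.
Qed.

Lemma ord_eq_neq0 f i p n : dom i p -> ord_eq i f p n ->
  \forall q \near p^', f q != 0.
Proof.
move=> ip [h [ah fh] h0].
have hn0 : \forall q \near p^', h (coord i q) != 0.
  exact: (cvgr_neq0 _ (analytic_cvg ip ah) h0).
apply: filterS3 fh hn0 (near_coord_sub0 ip) => q -> hq cq.
by rewrite mulf_neq0 // expfz_neq0.
Qed.

Lemma regular_ord_ge f i p : regular_at i f p -> ord_ge i f p 0.
Proof.
move=> [h ah fh]; exists h; split => //.
by apply: dnbhs_nbhs; apply: filterS fh => q ->; rewrite expr0z mul1r.
Qed.

Lemma regular_root f i p : dom i p -> regular_at i f p -> f p = 0 -> ord_ge i f p 1.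
Proof.
move=> ip [h ah fh] fp0.
have h0 : h (coord i p) = 0 by rewrite -(nbhs_singleton fh).
have [h' ah' hh'] := analytic_root ah h0; exists h'; split=> //.
apply: dnbhs_nbhs; apply: filterS2 fh (near_coord ip hh') => q -> ->.
by rewrite expr1z.
Qed.

Lemma regular_continuous f i p : dom i p -> regular_at i f p ->
  {for p, continuous f}.
Proof.
move=> ip [h ah fh].
have hc := analytic_comp_continuous ip (analytic_continuous_at ah).
rewrite /prop_for /continuous_at (nbhs_singleton fh).
apply: cvg_trans hc; apply: near_eq_cvg.
by apply: filterS fh => q ->.
Qed.

Lemma regularD f f' i p : regular_at i f p -> regular_at i f' p ->
  regular_at i (fun q => f q + f' q) p.
Proof.
move=> [h ah fh] [h' ah' fh']; exists (fun w => h w + h' w).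
  exact: analyticD ah ah'.
by apply: filterS2 fh fh' => q -> ->.
Qed.

Lemma regular_cst (c : K) i p : regular_at i (fun=> c) p.
Proof. by exists (fun=> c); [exact: analytic_cst | exact: filterE]. Qed.

Lemma regularM f f' i p : regular_at i f p -> regular_at i f' p ->
  regular_at i (fun q => f q * f' q) p.
Proof.
move=> [h ah fh] [h' ah' fh']; exists (fun w => h w * h' w).
  exact: analyticM ah ah'.
by apply: filterS2 fh fh' => q -> ->.
Qed.

Lemma regular_sum (I : Type) (r : seq I) (F : I -> X -> K) i p :
  (forall k, regular_at i (F k) p) -> regular_at i (fun q => \sum_(k <- r) F k q) p.
Proof.
move=> hF; elim: r => [|k r IH].
  by under eq_fun do rewrite big_nil; exact: regular_cst.
by under eq_fun do rewrite big_cons; exact: regularD.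
Qed.

(** At [q != p] the centred coordinate is nonzero, so its integer power is continuous there even
    when [n < 0]. *)
Lemma ord_ge_continuous f i p n : dom i p -> ord_ge i f p n ->
  \forall q \near p^', {for q, continuous f}.
Proof.
move=> ip [h [ah fh]].
have hc := dnbhs_nbhs (near_coord ip (analytic_continuous ah)).
have hd := dnbhs_nbhs (near_dom ip).
apply: filterS2 (near_coord_sub0 ip) (filterI (filterI (dnbhs_join fh) hc) hd).
move=> q cq0 [[fq hq] iq].
rewrite /prop_for /continuous_at (nbhs_singleton fq).
apply: (@cvg_trans _ ((coord i q' - coord i p) ^ n * h (coord i q') @[q' --> q])).
  by apply: near_eq_cvg; apply: filterS fq => q' ->.
have hhq := analytic_comp_continuous iq hq.
apply: cvgM; last exact: hhq.
have cc : coord i q' - coord i p @[q' --> q] --> coord i q - coord i p.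
  by apply: cvgB (cvg_cst _); exact: coord_cont.
case: n {fh fq} => m.
  exact: (cvg_exprn cc).
apply: cvgV; first by rewrite expf_neq0.
exact: (cvg_exprn cc).
Qed.

Lemma ord_ge0_cvg f i p : dom i p -> ord_ge i f p 0 ->
  exists l : K, f q @[q --> p^'] --> l.
Proof.
move=> ip [h [ah fh]]; exists (h (coord i p)).
apply: eq_near_cvg (analytic_cvg ip ah).
by apply: filterS fh => q ->; rewrite expr0z mul1r.
Qed.

(** For [n = -(m + 1)], the product of [f] with the power [m + 1] of the centred coordinate would
    tend both to 0 and to the nonzero leading coefficient. *)
Lemma cvg_ord_eq f i p n (l : K) : dom i p -> f q @[q --> p^'] --> l ->
  ord_eq i f p n -> 0 <= n.
Proof.
move=> ip fl [h [ah fh] h0]; case: n fh => // m fh; exfalso.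
have c1 : (coord i q - coord i p) ^+ m.+1 * f q @[q --> p^'] --> 0 ^+ m.+1 * l.
  exact: (cvgM (cvg_exprn (cvg_coord_sub ip)) fl).
have c2 : (coord i q - coord i p) ^+ m.+1 * f q @[q --> p^'] --> h (coord i p).
  apply: eq_near_cvg (analytic_cvg ip ah).
  apply: filterS2 fh (near_coord_sub0 ip) => q -> cq.
  by rewrite NegzE -exprnN mulrA mulfV ?mul1r // expf_neq0.
move: h0; rewrite -(cvg_dnbhs_unique c1 c2) expr0n mul0r eqxx //.
Qed.

End Germs.

(** * Sections of line bundles *)

Section Bundles.
Variables (R : realType) (X : topologicalType) (A : atlas R X).
Hypothesis hausX : hausdorff_space X.
Local Notation K := (Cplx R).
Implicit Types (i j : chart A) (p q : X) (f : X -> K) (n : int).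
Implicit Types (g : cocycle A) (s : section A).

Local Opaque analytic_at.
Local Instance dnbhs_proper_atlas p : ProperFilter p^' := dnbhs_proper A p.

(** Continuity is common to holomorphic and flat cocycles and passes to tensor products; it suffices
    to carry limits from one chart to another. *)
Definition continuous_cocycle g :=
  is_cocycle g /\
  forall i j p, dom i p -> dom j p -> {for p, continuous (g i j)}.

(** The transition rule alone, for intermediate sections whose values at isolated points may be
    wrong. *)
Definition compatible g s :=
  forall i j p, dom i p -> dom j p -> s i p = g i j p * s j p.

Lemma continuous_cvg_dnbhs f p : {for p, continuous f} -> f q @[q --> p^'] --> f p.
Proof. by move=> fc; exact: cvg_within_filter fc. Qed.

Lemma holomorphic_continuous f i p : dom i p ->
  holomorphic_at (f \o param i) (coord i p) -> {for p, continuous f}.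
Proof.
move=> ip /nbhs_singleton /derivable1_diffP /differentiable_continuous fc.
have := continuous_comp (coord_cont ip) fc.
rewrite /prop_for /continuous_at /= (coordK ip); apply: cvg_trans.
by apply: near_eq_cvg; apply: filterS (near_dom ip) => q iq /=; rewrite coordK.
Qed.

Lemma continuous_tensor g g' : continuous_cocycle g -> continuous_cocycle g' ->
  continuous_cocycle (tensor g g').
Proof.
move=> [[g1 g2] gc] [[g1' g2'] gc']; split; first split.
- by move=> i p ip; rewrite /tensor g1 // g1' // mulr1.
- by move=> i j k p ip jp kp; rewrite /tensor (g2 i j k) // (g2' i j k) // mulrACA.
- by move=> i j p ip jp; exact: cvgM (gc i j p ip jp) (gc' i j p ip jp).
Qed.

Lemma holomorphic_bundle_continuous g : holomorphic_bundle g -> continuous_cocycle g.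
Proof.
move=> [gc gh]; split=> // i j p ip jp.
exact: holomorphic_continuous ip (gh i j p ip jp).
Qed.

Lemma flat_bundle_continuous g : flat_bundle g -> continuous_cocycle g.
Proof.
move=> [gc gl]; split=> // i j p ip jp.
apply: (@cvg_trans _ ((fun=> g i j p) q @[q --> p])); last exact: cvg_cst.
by apply: near_eq_cvg; apply: filterS (gl i j p ip jp) => q ->.
Qed.

Lemma cvg_compatible g s i j p (l : K) : continuous_cocycle g -> compatible g s ->
  dom i p -> dom j p -> s j q @[q --> p^'] --> l ->
  s i q @[q --> p^'] --> g i j p * l.
Proof.
move=> [_ gc] gs ip jp sl.
have gl : g i j q @[q --> p^'] --> g i j p := continuous_cvg_dnbhs (gc i j p ip jp).
apply: eq_near_cvg (cvgM gl sl).
apply: filterS2 (dnbhs_nbhs (near_dom ip)) (dnbhs_nbhs (near_dom jp)).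
by move=> q iq jq /=; rewrite -gs.
Qed.

(** The ratio is a difference quotient of the transition map [coord i \o param j], so its limit is
    the derivative at [coord j p]. *)
Lemma cvg_coord_ratio i j p : dom i p -> dom j p ->
  exists l : K, (coord i q - coord i p) / (coord j q - coord j p) @[q --> p^'] --> l.
Proof.
move=> ip jp; have := transition_holo jp ip => /nbhs_singleton.
rewrite /derivable => /cvg_ex[l hl]; exists l.
have cj : coord j q - coord j p @[q --> p^'] --> (0 : K)^'.
  move=> P; rewrite /= {1}/dnbhs /= /within /= => hP.
  have := cvg_coord_sub jp hP; rewrite /= /nbhs /= => hP'.
  by apply: filterS2 hP' (near_coord_sub0 jp) => q /= h1 h2; exact: h1.
have := cvg_comp _ _ cj hl; apply: eq_near_cvg.
have hj := dnbhs_nbhs (near_dom jp).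
apply: filterS hj => q jq /=.
by rewrite /GRing.scale /= mulr1 subrK !coordK // mulrC.
Qed.

(* A chart change has a finite derivative, so the ratio of the two centred
   coordinates converges at p; hence the order cannot drop below - m. *)
Lemma ord_eq_compatible g s i j p (m : nat) n : continuous_cocycle g ->
  compatible g s -> dom i p -> dom j p ->
  ord_ge j (s j) p (- m%:Z) -> ord_eq i (s i) p n -> - m%:Z <= n.
Proof.
move=> gc gs ip jp [hj [ahj shj]] [hi [ahi shi] hi0].
have [l hl] := cvg_coord_ratio ip jp.
pose G q := g i j q * ((coord i q - coord i p) / (coord j q - coord j p)) ^+ m
  * hj (coord j q).
have gl : g i j q @[q --> p^'] --> g i j p := continuous_cvg_dnbhs (gc.2 i j p ip jp).
have cG : G q @[q --> p^'] --> g i j p * l ^+ m * hj (coord j p).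
  exact: (cvgM (cvgM gl (cvg_exprn hl)) (analytic_cvg jp ahj)).
have oG : ord_eq i G p (m%:Z + n).
  exists hi => //; split=> //.
  apply: filterS3 (filterI shj shi)
    (filterI (near_coord_sub0 ip) (near_coord_sub0 jp))
    (filterI (dnbhs_nbhs (near_dom ip)) (dnbhs_nbhs (near_dom jp))).
  move=> q [sj si] [ci0 cj0] [iq jq].
  have := gs i j q iq jq; rewrite si sj => gsq.
  rewrite /G expfzDr // -[RHS]mulrA gsq -exprnP -exprnN expr_div_n.
  by rewrite !mulrA; congr (_ * _); rewrite -!mulrA mulrCA.
by have := cvg_ord_eq ip cG oG; rewrite -lerBlDl sub0r.
Qed.

Lemma ord_ge_chart g s i j p (m : nat) : continuous_cocycle g ->
  meromorphic_section g s -> dom i p -> dom j p ->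
  ord_ge j (s j) p (- m%:Z) -> ord_ge i (s i) p (- m%:Z).
Proof.
move=> gc [gs sm] ip jp sj.
have [/regular_ord_ge si|[n _ si]] := sm i p ip.
  by apply: ord_ge_le ip _ si; rewrite oppr_le0.
apply: (ord_ge_le ip _ (ord_eq_ge si)).
exact: ord_eq_compatible gc gs ip jp sj si.
Qed.

Lemma ord_ge0_regular g s i p : meromorphic_section g s -> dom i p ->
  ord_ge i (s i) p 0 -> regular_at i (s i) p.
Proof.
move=> [_ sm] ip s0; have [//|[n n0 sn]] := sm i p ip.
have [l sl] := ord_ge0_cvg ip s0.
by have := cvg_ord_eq ip sl sn; rewrite leNgt n0.
Qed.

(* The value 0 at the remaining points, the poles, satisfies the transition
   rule in every chart. *)
Definition regularization s : section A := fun i p =>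
  if pselect (exists l : K, s i q @[q --> p^'] --> l) is left e
  then sval (cid e) else 0.

Lemma regularization_cvg s i p (l : K) : s i q @[q --> p^'] --> l ->
  regularization s i p = l.
Proof.
move=> sl; rewrite /regularization; case: pselect => [e|[]]; last by exists l.
by case: (cid e) => l' /= sl'; exact: (cvg_dnbhs_unique A sl' sl).
Qed.

Lemma regularization_Ncvg s i p : ~ (exists l : K, s i q @[q --> p^'] --> l) ->
  regularization s i p = 0.
Proof. by move=> sN; rewrite /regularization; case: pselect. Qed.

Lemma regularization_eq s i p n : dom i p -> ord_ge i (s i) p n ->
  \forall q \near p^', regularization s i q = s i q.
Proof.
move=> ip /(ord_ge_continuous hausX ip); apply: filterS => q sq.
by apply: regularization_cvg; exact: continuous_cvg_dnbhs sq.
Qed.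

Lemma regularization_compatible g s : continuous_cocycle g -> compatible g s ->
  compatible g (regularization s).
Proof.
move=> gc gs i j p ip jp.
have [[l sl]|sN] := pselect (exists l : K, s j q @[q --> p^'] --> l).
  rewrite (regularization_cvg sl); apply: regularization_cvg.
  exact: cvg_compatible gc gs ip jp sl.
rewrite (regularization_Ncvg sN) mulr0; apply: regularization_Ncvg => -[l sl].
by apply: sN; exists (g j i p * l); exact: cvg_compatible gc gs jp ip sl.
Qed.

(** Sums and quotients of sections may take wrong values where poles cancel, while [H0] requires
    correct ones at regular points. Replacing values by limits repairs this without changing the
    germs off their centres. *)
Lemma regularization_meromorphic g s (D : X -> int) : continuous_cocycle g ->
  compatible g s -> (forall i p, dom i p -> ord_ge i (s i) p (- D p)) ->
  H0 g D (regularization s).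
Proof.
move=> gc gs sD; split; last first.
  move=> i p ip; apply: eq_near_ord_ge (sD i p ip).
  by apply: filterS (regularization_eq ip (sD i p ip)) => q ->.
split; first exact: regularization_compatible.
move=> i p ip; have re := regularization_eq ip (sD i p ip).
have reg h : analytic_at h (coord i p) ->
    (\forall q \near p^', s i q = h (coord i q)) ->
    regular_at i (regularization s i) p.
  move=> ah sh; exists h => //.
  have rp : regularization s i p = h (coord i p).
    apply: regularization_cvg; apply: eq_near_cvg (analytic_cvg ip ah).
    by apply: filterS sh => q ->.
  have : \forall q \near p^', regularization s i q = h (coord i q).
    by apply: filterS2 re sh => q -> ->.
  rewrite near_withinE; apply: filterS => q hq.
  by have [->|/hq] := eqVneq q p.
have [h [ah sh]] := sD i p ip; set n := - D p in sh.
(* The zeros of [h] may compensate the bound [n]: the true order is [n + m], and its sign decides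
   between a regular point and a pole. *)
have [h0|[m [h' [ah' h'0] hh']]] := analytic_factor ah.
  left; apply: (reg (fun=> 0)); first exact: analytic_cst.
  apply: filterS2 sh (dnbhs_nbhs (near_coord ip h0)) => q -> ->.
  by rewrite mulr0.
have sh' : \forall q \near p^', s i q = (coord i q - coord i p) ^ (n + m%:Z) * h' (coord i q).
  apply: filterS3 sh (dnbhs_nbhs (near_coord ip hh')) (near_coord_sub0 ip).
  by move=> q -> -> cq; rewrite expfzDr // mulrA.
have [nm0|nm0] := leP 0 (n + m%:Z).
  left; apply: (reg (fun w => (w - coord i p) ^+ absz (n + m%:Z)%R * h' w)).
    exact: analyticM (analyticX _ (analytic_coord _ _)) ah'.
  by apply: filterS sh' => q ->; rewrite -{1}(gez0_abs nm0).
right; exists (n + m%:Z) => //; exists h' => //; split=> //.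
by apply: filterS2 re sh' => q -> ->.
Qed.

(** In one chart the section is continuous at all points near [p] other than [p]. The limit
    transfers to every chart, which excludes a pole there. *)
Lemma poles_isolated g s p : continuous_cocycle g -> meromorphic_section g s ->
  \forall q \near p^', ~ has_pole s q.
Proof.
move=> gc [gs sm]; have [i ip] := dom_cover A p.
have [n sn] : exists n, ord_ge i (s i) p n.
  have [/regular_ord_ge ?|[n _ /ord_eq_ge ?]] := sm i p ip; first by exists 0.
  by exists n.
apply: filterS2 (ord_ge_continuous hausX ip sn) (dnbhs_nbhs (near_dom ip)).
move=> q sq iq [j jq [m m0 sj]].
have sqi : s i q' @[q' --> q^'] --> s i q := continuous_cvg_dnbhs sq.
have := cvg_ord_eq jq (cvg_compatible gc gs jq iq sqi) sj.
by rewrite leNgt m0.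
Qed.

Lemma finite_poles g s : compact [set: X] -> continuous_cocycle g ->
  meromorphic_section g s -> finite_set [set p | has_pole s p].
Proof.
move=> /compact_near_coveringP cX gc sm.
(* The properties true of all sufficiently large finite sets form a filter. Applied to it, the
   near-covering form of compactness turns local finiteness into one finite set containing all
   poles. *)
pose F : set_system (set X) := fun U =>
  exists2 D, finite_set D & forall E, finite_set E -> D `<=` E -> U E.
have FF : Filter F.
  split.
  - by exists set0.
  - move=> P Q [D fD PD] [E fE QE]; exists (D `|` E); first by rewrite finite_setU.
    move=> G fG; rewrite subUset => -[DG EG]; split; [exact: PD | exact: QE].
  - by move=> P Q PQ [D fD PD]; exists D => // E fE /(PD E fE)/PQ.
have [] := cX _ F (fun E p => has_pole s p -> E p) FF.
  move=> p _; have := poles_isolated p gc sm; rewrite near_withinE => hp.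
  exists ([set q | q != p -> ~ has_pole s q], [set E | E p]).
    by split => //=; exists [set p] => // E _; exact.
  move=> [q E] /= [hq Ep] sq; have [->//|qp] := eqVneq q p.
  by case: (hq qp).
move=> D fD /(_ D fD (@subset_refl _ D)) hD.
by apply: sub_finite_set fD => p; apply: hD.
Qed.

End Bundles.

(** * The frame given by a basis *)

Section Covering.
Variables (R : realType) (X : topologicalType) (A : atlas R X).
Local Notation K := (Cplx R).
Implicit Types (i j : chart A) (p q : X) (s : section A).

Local Opaque analytic_at.
Local Instance dnbhs_proper_covering p : ProperFilter p^' := dnbhs_proper A p.

Variables (Z : X -> option K) (Xi : X -> int).
Hypotheses (hZ : meromorphic_map A Z) (hXi : polar_divisor A Z Xi).
Local Notation f := (finite_part Z).

Lemma finite_partE p z : Z p = Some z -> f p = z.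
Proof. by rewrite /finite_part => ->. Qed.

Lemma regular_finite_part i p z : dom i p -> Z p = Some z -> regular_at i f p.
Proof. by move=> ip Zp; have := hZ ip; rewrite Zp. Qed.

Lemma polar_divisor_Some p z : Z p = Some z -> Xi p = 0.
Proof. by move=> Zp; have := hXi.2 p; rewrite Zp. Qed.

Lemma polar_divisor_ge0 p : 0 <= Xi p.
Proof. by have := hXi.2 p; case: (Z p) => [_ ->//|[/ltW]]. Qed.

Lemma ord_ge_finite_part i p : dom i p -> ord_ge i f p (- Xi p).
Proof.
move=> ip; case Zp : (Z p) => [z|].
  rewrite (polar_divisor_Some Zp) oppr0.
  exact: regular_ord_ge (regular_finite_part ip Zp).
by have := hXi.2 p; rewrite Zp => -[_ /(_ i ip)/ord_eq_ge].
Qed.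

Lemma ord_ge_horner (P : {poly K}) i p : dom i p ->
  ord_ge i (fun q => P.[f q]) p (- ((size P).-1%:Z * Xi p)).
Proof.
move=> ip; under eq_fun do rewrite horner_coef.
apply: ord_ge_sum => k; apply: (ord_geZ _ ip).
apply: (ord_ge_le ip _ (ord_geX k ip (ord_ge_finite_part ip))).
rewrite mulNrn lerN2 -mulr_natl.
apply: ler_wpM2r; first exact: polar_divisor_ge0.
by rewrite natz lez_nat -ltnS (leq_trans (ltn_ord k)) // leqSpred.
Qed.

Lemma regular_horner (P : {poly K}) i p z : dom i p -> Z p = Some z ->
  regular_at i (fun q => P.[f q]) p.
Proof.
move=> ip Zp; have fp := regular_finite_part ip Zp.
elim/poly_ind: P => [|P c IH].
  by under eq_fun do rewrite horner0; exact: regular_cst.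
under eq_fun do rewrite hornerMXaddC.
exact: regularD (regularM IH fp) (regular_cst c i p).
Qed.

Lemma ord_eq_sub_regular i p z z0 : dom i p -> Z p = Some z -> z != z0 ->
  ord_eq i (fun q => f q - z0) p 0.
Proof.
move=> ip Zp zz0; have [h ah fh] := regularD (regular_finite_part ip Zp) (regular_cst (- z0) i p).
exists h; last by rewrite -(nbhs_singleton fh) (finite_partE Zp) subr_eq0.
by split=> //; apply: dnbhs_nbhs; apply: filterS fh => q ->; rewrite expr0z mul1r.
Qed.

Lemma ord_eq_sub_pole i p z0 : dom i p -> Z p = None ->
  ord_eq i (fun q => f q - z0) p (- Xi p).
Proof.
move=> ip Zp; have := hXi.2 p; rewrite Zp => -[X0 /(_ i ip)[h [ah fh] h0]].
have [n Xn] : exists n : nat, Xi p = n.+1%:Z.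
  by case: (Xi p) X0 => [[|n]|n] // _; exists n.
(* The pole order is at least 1, so the term coming from [z0] vanishes at the pole and leaves the
   leading coefficient unchanged. *)
exists (fun w => h w + - z0 * (w - coord i p) ^+ n.+1); last first.
  by rewrite subrr expr0n mulr0 addr0.
split.
  apply: analyticD ah _; apply: analyticM (analytic_cst _ _) _.
  exact: analyticX (analytic_coord _ _).
apply: filterS2 fh (near_coord_sub0 ip) => q -> cq.
rewrite mulrDr Xn -exprnN mulrCA mulVf ?mulr1 //.
by rewrite expf_neq0.
Qed.

(** Links the derivative in the definition of ramification to the leading coefficient of the
    expansion of [Z - z0]: at noncritical values all zeros are simple. *)
Lemma derive1_root (F h : K -> K) (a z0 : K) : analytic_at h a ->
  (\forall w \near a, F w = z0 + (w - a) * h w) -> derive1 F a = h a.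
Proof.
move=> ah Fh; apply: cvg_lim; first exact: norm_hausdorff.
have ka : k + a @[k --> (0 : K)^'] --> a.
  rewrite -[X in _ --> X]add0r; apply: cvgD (cvg_cst _).
  exact: nbhs_dnbhs.
have hka : h (k + a) @[k --> (0 : K)^'] --> h a.
  exact: (cvg_comp _ _ ka (analytic_continuous_at ah)).
apply: cvg_trans hka; apply: near_eq_cvg.
have Fk : \forall k \near (0 : K)^', F (k + a) = z0 + (k + a - a) * h (k + a) := ka _ Fh.
have k0 : \forall k \near (0 : K)^', k != 0 by exact: nbhs_dnbhs_neq.
apply: filterS2 Fk k0 => k Fk k0.
rewrite Fk (nbhs_singleton Fh) subrr mul0r addr0 addrK [z0 + _]addrC addrK.
by rewrite /GRing.scale /= mulrA mulVf // mul1r.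
Qed.

Lemma ord_eq_sub_noncritical i p z0 : ~ critical_value A Z (Some z0) ->
  dom i p -> Z p = Some z0 -> ord_eq i (fun q => f q - z0) p 1.
Proof.
move=> ncrit ip Zp.
have [h ah fh] := regularD (regular_finite_part ip Zp) (regular_cst (- z0) i p).
have h0 : h (coord i p) = 0 by rewrite -(nbhs_singleton fh) (finite_partE Zp) subrr.
have [h' ah' hh'] := analytic_root ah h0.
exists h'.
  split=> //; apply: dnbhs_nbhs.
  by apply: filterS2 fh (near_coord ip hh') => q -> ->; rewrite expr1z.
apply: contra_notN ncrit => /eqP h'0; exists p => //; exists i => //.
rewrite Zp (derive1_root (z0 := z0) ah') //.
apply: filterS3 (near_param ip fh) hh' (near_param_coord ip) => w /= fw hw cw.
by rewrite cw hw in fw; rewrite -fw addrC subrK.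
Qed.

Lemma near_sub_neq0 i p z0 : ~ critical_value A Z (Some z0) -> dom i p ->
  \forall q \near p^', f q - z0 != 0.
Proof.
move=> ncrit ip; case Zp : (Z p) => [z|]; last first.
  exact: ord_eq_neq0 ip (ord_eq_sub_pole z0 ip Zp).
have [zz0|zz0] := eqVneq z z0.
  by apply: ord_eq_neq0 ip (ord_eq_sub_noncritical ncrit ip _); rewrite Zp zz0.
exact: ord_eq_neq0 ip (ord_eq_sub_regular ip Zp zz0).
Qed.

(** Division by [f - z0] gains [Xi p] at a pole of [Z], costs one order on the fibre over the
    noncritical [z0], and changes nothing elsewhere. The assumed zero of [u] pays for the fibre. *)
Lemma ord_ge_quotient (N : nat) (u : X -> K) i p z0 :
  ~ critical_value A Z (Some z0) -> dom i p ->
  ord_ge i u p (- (N.+1%:Z * Xi p)) -> (Z p = Some z0 -> ord_ge i u p 1) ->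
  ord_ge i (fun q => u q / (f q - z0)) p (- (N%:Z * Xi p)).
Proof.
move=> ncrit ip uN u1; case Zp : (Z p) => [z|]; last first.
  have -> : - (N%:Z * Xi p) = - (N.+1%:Z * Xi p) - - Xi p.
    by rewrite -natz -(natz N.+1) mulrSr; ring.
  exact: ord_geM ip uN (ord_geV ip (ord_eq_sub_pole z0 ip Zp)).
rewrite (polar_divisor_Some Zp) mulr0 oppr0.
have [zz0|zz0] := eqVneq z z0.
  rewrite -(subrr 1); rewrite zz0 in Zp.
  exact: ord_geM ip (u1 Zp) (ord_geV ip (ord_eq_sub_noncritical ncrit ip Zp)).
rewrite -(subrr 0); move: uN; rewrite (polar_divisor_Some Zp) mulr0 oppr0 => uN.
exact: ord_geM ip uN (ord_geV ip (ord_eq_sub_regular ip Zp zz0)).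
Qed.

End Covering.

(** Serves the behaviour at infinity, where the terms of a determinant of polynomials are compared
    with the common denominator. *)
Lemma size_prod_le (F : idomainType) (I : Type) (r : seq I) (p q : I -> {poly F}) :
  (forall i, q i != 0) -> (forall i, (size (p i) <= size (q i))%N) ->
  (size (\prod_(i <- r) p i)%R <= size (\prod_(i <- r) q i)%R)%N.
Proof.
move=> q0 pq; elim: r => [|i r IH]; first by rewrite !big_nil.
have prod_q0 : \prod_(i <- r) q i != 0.
  by elim/big_ind: _ => [|x y|//]; [exact: oner_neq0 | exact: mulf_neq0].
rewrite !big_cons (size_mul (q0 i) prod_q0).
apply: leq_trans (size_polyMleq _ _) _.
by rewrite -!subn1 leq_sub2r // leq_add.
Qed.

(** * Expansion of meromorphic sections in the frame *)

Section Frame.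
Variables (R : realType) (X : topologicalType) (A : atlas R X).
Local Notation K := (Cplx R).
Implicit Types (i j : chart A) (p q : X) (s : section A).
Hypothesis hX : compact_riemann_surface A.
Let hausX : hausdorff_space X.
Proof. by case: hX. Qed.

Local Opaque analytic_at.
Local Instance dnbhs_proper_frame p : ProperFilter p^' := dnbhs_proper A p.

Variables (g : cocycle A).
Hypotheses (gc : continuous_cocycle g) (g0 : h0_vanishes g).
Variables (Z : X -> option K) (Xi : X -> int).
Hypotheses (hZ : meromorphic_map A Z) (hXi : polar_divisor A Z Xi).
Local Notation f := (finite_part Z).
Variables (r : nat) (sh : K -> 'I_r -> X) (tr : X -> chart A).
Hypotheses (hsh : sheets A Z sh) (htr : forall p, dom (tr p) p).
Variable phi : 'I_r -> section A.
Hypothesis hphi : H0_basis g Xi phi.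

Definition frame_comb (M : 'I_r -> {poly K}) : section A :=
  fun i q => \sum_k (M k).[f q] * phi k i q.

Let phi_H0 k : H0 g Xi (phi k). Proof. by case: hphi. Qed.

Lemma compatible_lincomb c : compatible g (lincomb c phi).
Proof.
move=> i j p ip jp; rewrite /lincomb mulr_sumr; apply: eq_bigr => k _.
by rewrite ((phi_H0 k).1.1 i j) // mulrCA.
Qed.

Lemma regular_basis k i p z : dom i p -> Z p = Some z -> regular_at i (phi k i) p.
Proof.
move=> ip Zp; apply: (ord_ge0_regular (phi_H0 k).1 ip).
by have := (phi_H0 k).2 i p ip; rewrite (polar_divisor_Some hXi Zp) oppr0.
Qed.

Lemma regular_lincomb c i p z : dom i p -> Z p = Some z ->
  regular_at i (lincomb c phi i) p.
Proof.
move=> ip Zp; apply: regular_sum => k.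
exact: regularM (regular_cst (c k) i p) (regular_basis k ip Zp).
Qed.

(** The vanishing of [h^0] is applied to the regularization, which has the same germs off isolated
    points. *)
Lemma ord_ge0_vanishes s : compatible g s ->
  (forall i p, dom i p -> ord_ge i (s i) p 0) -> section_eq s (@zero_section R X A).
Proof.
move=> gs s0 i p ip.
have s0' j q : dom j q -> ord_ge j (s j) q (- (fun=> 0 : int) q).
  by move=> jq; rewrite oppr0; exact: s0.
have := g0 (regularization_meromorphic hausX gc gs s0') ip.
apply: filterS2 (regularization_eq hausX ip (s0 i p ip)) => q -> //.
Qed.

Lemma det_basis_neq0 z0 : ~ critical_value A Z (Some z0) ->
  det_sections tr sh phi z0 != 0.
Proof.
(* A kernel row vector of the matrix is a combination of the basis that vanishes at every point of
   the fibre. *)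
move=> ncrit; apply/negP => /det0P[c c0 cPhi].
pose s : section A := lincomb (c 0) phi.
have gs : compatible g s := compatible_lincomb (c 0).
have sXi i p : dom i p -> ord_ge i (s i) p (- Xi p).
  move=> ip; apply: ord_ge_sum => k; apply: (ord_geZ _ ip).
  exact: (phi_H0 k).2.
have sfib i p : dom i p -> Z p = Some z0 -> ord_ge i (s i) p 1.
  move=> ip Zp; apply: (regular_root ip (regular_lincomb (c 0) ip Zp)).
  (* The kernel relation is written in the trivialization [tr p]; the transition factor carries the
     zero over to the chart [i]. *)
  rewrite -/(s i) (gs i (tr p)) //.
  have [_ _ /(_ p Zp)[a _ <-]] := hsh ncrit.
  have /matrixP/(_ 0 a) := cPhi; rewrite !mxE => cPhia.
  rewrite /s /lincomb -[RHS](mulr0 (g i (tr (sh z0 a)) (sh z0 a))) -[in RHS]cPhia.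
  by congr (_ * _); apply: eq_bigr => k _; rewrite mxE.
pose t : section A := fun i q => s i q / (f q - z0).
have t0 : section_eq t (@zero_section R X A).
  apply: ord_ge0_vanishes => [i j p ip jp|i p ip].
    by rewrite /t (gs i j) // mulrA.
  rewrite -[0]oppr0 -(mul0r (Xi p)).
  by apply: (ord_ge_quotient hZ hXi ncrit ip); [rewrite mul1r; exact: sXi | exact: sfib].
(* The factor [f - z0] has no zero on small punctured neighbourhoods, so [s] vanishes with its
   quotient. *)
have s0 : section_eq s (@zero_section R X A).
  move=> i p ip; apply: filterS2 (t0 i p ip) (near_sub_neq0 hZ hXi ncrit ip).
  move=> q /eqP; rewrite /t /zero_section mulf_eq0 invr_eq0 => /orP[/eqP //|->//].
case: hphi => _ /(_ (c 0) s0) call _; case/negP: c0; apply/eqP/rowP => k.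
by rewrite call mxE.
Qed.

Lemma frame_expansion z0 (N : nat) s : ~ critical_value A Z (Some z0) ->
  compatible g s ->
  (forall i p, dom i p -> ord_ge i (s i) p (- (N%:Z * Xi p))) ->
  exists2 M : 'I_r -> {poly K}, forall k, (size (M k) <= N)%N & section_eq s (frame_comb M).
Proof.
move=> ncrit; elim: N s => [|N IH] s gs sN.
  exists (fun=> 0) => [k|i p ip]; first by rewrite size_poly0.
  have s0 : section_eq s (@zero_section R X A).
    by apply: ord_ge0_vanishes => // j q jq; have := sN j q jq; rewrite mul0r oppr0.
  apply: filterS (s0 i p ip) => q ->; rewrite /zero_section /frame_comb big1 // => k _.
  by rewrite horner0 mul0r.
set D := fun p => N.+1%:Z * Xi p in sN.
have ms := regularization_meromorphic hausX gc gs sN.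
set s' := regularization s in ms.
pose Phi := \matrix_(j < r, a < r) phi j (tr (sh z0 a)) (sh z0 a).
have Phi_unit : Phi \in unitmx by rewrite unitmxE unitfE; exact: det_basis_neq0.
(* Interpolation on the fibre over [z0]: these coefficients match the values of [s'], which the
   regularization has made correct at those points. *)
pose c := (\row_a s' (tr (sh z0 a)) (sh z0 a)) *m invmx Phi.
pose t : section A := fun i q => s' i q + - 1 * lincomb (c 0) phi i q.
have gl := compatible_lincomb (c 0).
have gt : compatible g t.
  by move=> i j p ip jp; rewrite /t (ms.1.1 i j) // (gl i j) // mulrDr mulrCA.
have tN i p : dom i p -> ord_ge i (t i) p (- (N.+1%:Z * Xi p)).
  move=> ip; apply: ord_geD; first exact: ms.2.
  apply: (ord_geZ _ ip); apply: ord_ge_sum => k; apply: (ord_geZ _ ip).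
  apply: (ord_ge_le ip _ ((phi_H0 k).2 i p ip)).
  by rewrite lerN2 ler_peMl // (polar_divisor_ge0 hXi).
have tfib i p : dom i p -> Z p = Some z0 -> ord_ge i (t i) p 1.
  move=> ip Zp; have Xp := polar_divisor_Some hXi Zp.
  apply: (regular_root ip).
    apply: regularD.
      apply: (ord_ge0_regular ms.1 ip).
      by have := ms.2 i p ip; rewrite /D Xp mulr0 oppr0.
    exact: regularM (regular_cst (- 1) i p) (regular_lincomb (c 0) ip Zp).
  rewrite (gt i (tr p)) //.
  have [_ _ /(_ p Zp)[a _ <-]] := hsh ncrit.
  have : (c *m Phi) 0 a = s' (tr (sh z0 a)) (sh z0 a) by rewrite mulmxKV // mxE.
  rewrite mxE (eq_bigr (fun k => c 0 k * phi k (tr (sh z0 a)) (sh z0 a))).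
    by rewrite /t /lincomb => ->; rewrite mulN1r subrr mulr0.
  by move=> k _; rewrite [Phi _ _]mxE.
pose u : section A := fun i q => t i q / (f q - z0).
have gu : compatible g u by move=> i j p ip jp; rewrite /u (gt i j) // mulrA.
have uN i p : dom i p -> ord_ge i (u i) p (- (N%:Z * Xi p)).
  by move=> ip; apply: (ord_ge_quotient hZ hXi ncrit ip); [exact: tN | exact: tfib].
have [M MN uM] := IH u gu uN.
(* This undoes the division, [s = (f - z0) u + sum_k c_k phi_k], and each step raises the size by at
   most one. *)
exists (fun k => ('X - z0%:P) * M k + (c 0 k)%:P) => [k|i p ip].
  rewrite (leq_trans (size_polyD _ _)) // geq_max (leq_trans (size_polyC_leq1 _)) // andbT.
  rewrite (leq_trans (size_polyMleq _ _)) // size_XsubC /=.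
  by rewrite ltnS.
apply: filterS3 (regularization_eq hausX ip (sN i p ip)) (uM i p ip)
  (near_sub_neq0 hZ hXi ncrit ip) => q sq uq zq.
rewrite /frame_comb.
under eq_bigr do rewrite hornerD hornerM hornerXsubC hornerC mulrDl -mulrA.
rewrite big_split /= -mulr_sumr -/(frame_comb M i q) -uq /u mulrC divfK //.
by rewrite /t mulN1r /s' sq subrK.
Qed.

(** By compactness there are finitely many poles. Each order is measured in the chart [tr p], and
    the bound then passes to all charts at [p]. *)
Lemma pole_order_bound psi : meromorphic_section g psi ->
  exists m : nat, forall i p, dom i p -> ord_ge i (psi i) p (- m%:Z).
Proof.
move=> mpsi; have [_ cX] : hausdorff_space X /\ compact [set: X] by case: hX.
have /finite_seqP[l polesE] := finite_poles hausX cX gc mpsi.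
have /choice[m_ hm] p : exists m : nat, ord_ge (tr p) (psi (tr p)) p (- m%:Z).
  have [/regular_ord_ge h|[n n0 /ord_eq_ge h]] := mpsi.2 (tr p) p (htr p).
    by exists 0%N; rewrite oppr0.
  by exists `|n|%N; rewrite ltz0_abs // opprK.
exists (\max_(p <- l) m_ p) => i p ip.
have [|[n n0 h]] := mpsi.2 i p ip.
  by move=> /regular_ord_ge; apply: (ord_ge_le ip); rewrite oppr_le0.
have pl : p \in l.
  have : [set p | has_pole psi p] p by exists i => //; exists n.
  by rewrite polesE.
apply: (ord_ge_le ip _ (ord_ge_chart gc mpsi ip (htr p) (hm p))).
by rewrite lerN2 lez_nat leq_bigmax_seq.
Qed.

Lemma no_pole_ord_ge0 psi i p : meromorphic_section g psi -> dom i p ->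
  ~ has_pole psi p -> ord_ge i (psi i) p 0.
Proof.
move=> mpsi ip pN; have [/regular_ord_ge //|h] := mpsi.2 i p ip.
by case: pN; exists i.
Qed.

(** A pole over a finite value [z] is cancelled by [(f - z)^m]. Poles over infinity cannot be
    cancelled in this way and are absorbed into [N]; the last clause keeps [N] small when there are
    none, for the degree comparison at infinity. *)
Lemma clear_poles psi : meromorphic_section g psi ->
  exists (Q : {poly K}) (N : nat),
  [/\ Q != 0,
      forall z, Q.[z] = 0 -> exists2 p, Z p = Some z & has_pole psi p,
      forall i p, dom i p ->
        ord_ge i (fun q => Q.[f q] * psi i q) p (- (N%:Z * Xi p)) &
      (forall p, Z p = None -> ~ has_pole psi p) -> (N <= size Q)%N].
Proof.
move=> mpsi; have [_ cX] : hausdorff_space X /\ compact [set: X] by case: hX.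
have /finite_seqP[l polesE] := finite_poles hausX cX gc mpsi.
have poleP p : has_pole psi p <-> p \in l.
  by rewrite -[has_pole psi p]/([set p | has_pole psi p] p) polesE.
have [m hm] := pole_order_bound mpsi.
pose F p : {poly K} := if Z p is Some z then ('X - z%:P) ^+ m else 1.
have F0 p : F p != 0.
  by rewrite /F; case: (Z p) => [z|]; rewrite ?oner_neq0 // expf_neq0 // polyXsubC_eq0.
pose Q := \prod_(p <- l) F p.
have Q0 : Q != 0 by rewrite prodf_seq_neq0; apply/allP => p _; rewrite F0.
pose noinf := `[< forall p, Z p = None -> ~ has_pole psi p >].
(* Over infinity [Q(f)] has a pole of order at most [deg Q * Xi p], and [psi] adds at most
   [m <= m * Xi p] because [Xi p >= 1]. *)
pose N := ((size Q).-1 + (if noinf then 0 else m))%N.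
exists Q, N; split=> //.
- move=> z; rewrite /Q horner_prod => /eqP; rewrite prodf_seq_eq0 => /hasP[p pl].
  rewrite /F /=; case Zp : (Z p) => [z'|]; last by rewrite hornerC oner_eq0.
  rewrite horner_exp hornerXsubC expf_eq0 subr_eq0 => /andP[_ /eqP zz'].
  by exists p; [rewrite Zp zz' | exact/poleP].
- move=> i p ip; have QX := ord_ge_horner hZ hXi Q ip.
  case Zp : (Z p) => [z|]; last first.
    rewrite /N /noinf; case: asboolP => [noinfP|_].
      rewrite addn0 -[X in ord_ge _ _ _ X]addr0.
      exact: (ord_geM ip QX (no_pole_ord_ge0 mpsi ip (noinfP p Zp))).
    apply: (ord_ge_le ip _ (ord_geM ip QX (hm i p ip))).
    rewrite PoszD mulrDl opprD lerD2l lerN2 ler_peMr //.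
    by have := hXi.2 p; rewrite Zp => -[].
  rewrite (polar_divisor_Some hXi Zp) mulr0 oppr0 -[0]addr0.
  have [pl|/negP pl] := boolP (p \in l); last first.
    have pN : ~ has_pole psi p by move/poleP.
    have Qp := regular_ord_ge (regular_horner hZ Q ip Zp).
    exact: (ord_geM ip Qp (no_pole_ord_ge0 mpsi ip pN)).
  (* The factor belonging to [p] alone cancels the pole there; the remaining product is regular at
     [p]. *)
  have QE : Q = F p * \prod_(p <- rem p l) F p by rewrite /Q (big_rem p).
  rewrite QE; under eq_fun do rewrite hornerM.
  have fz : ord_ge i (fun q => f q - z) p 1.
    apply: (regular_root ip); last by rewrite (finite_partE Zp) subrr.
    exact: regularD (regular_finite_part hZ ip Zp) (regular_cst (- z) i p).
  have Fp : ord_ge i (fun q => (F p).[f q]) p (m%:Z).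
    rewrite /F Zp; under eq_fun do rewrite horner_exp hornerXsubC.
    by rewrite -natz; exact: ord_geX.
  have Gp := regular_ord_ge (regular_horner hZ (\prod_(p <- rem p l) F p) ip Zp).
  rewrite addr0 -(subrr m%:Z) -[X in X - _]addr0.
  exact: (ord_geM ip (ord_geM ip Fp Gp) (hm i p ip)).
- move=> noinfP; rewrite /N /noinf; case: asboolP => // _.
  by rewrite addn0 leq_pred.
Qed.

Lemma section_expansion z0 psi : ~ critical_value A Z (Some z0) ->
  meromorphic_section g psi ->
  exists (Q : {poly K}) (M : 'I_r -> {poly K}),
  [/\ Q != 0,
      forall z, Q.[z] = 0 -> exists2 p, Z p = Some z & has_pole psi p,
      forall p z, Z p = Some z -> ~ has_pole psi p ->
        Q.[z] * psi (tr p) p = \sum_k (M k).[z] * phi k (tr p) p &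
      (forall p, Z p = None -> ~ has_pole psi p) ->
        forall k, (size (M k) <= size Q)%N].
Proof.
move=> ncrit mpsi; have [Q [N [Q0 QP QN NQ]]] := clear_poles mpsi.
have gQ : compatible g (fun i q => Q.[f q] * psi i q).
  by move=> i j p ip jp; rewrite (mpsi.1 i j) // mulrCA.
have [M MN QM] := frame_expansion ncrit gQ QN.
exists Q, M; split=> // [p z Zp pN|noinf k]; last exact: leq_trans (MN k) (NQ noinf).
have ip := htr p.
have rl : regular_at (tr p) (fun q => Q.[f q] * psi (tr p) q) p.
  apply: regularM; first exact: (regular_horner hZ _ ip Zp).
  exact: ord_ge0_regular mpsi ip (no_pole_ord_ge0 mpsi ip pN).
have rr : regular_at (tr p) (frame_comb M (tr p)) p.
  apply: regular_sum => k.
  exact: regularM (regular_horner hZ _ ip Zp) (regular_basis k ip Zp).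
(* The expansion is an identity off a discrete set. Both sides are regular at [p], so their values
   there agree as limits. *)
have cl := continuous_cvg_dnbhs (regular_continuous ip rl).
have cr := continuous_cvg_dnbhs (regular_continuous ip rr).
have := cvg_dnbhs_unique A (eq_near_cvg (QM _ p ip) cl) cr.
by rewrite /frame_comb (finite_partE Zp).
Qed.

End Frame.

(** * Fractions in lowest terms and the conclusion *)

Lemma reduced_fraction (F : fieldType) (P0 Q0 : {poly F}) : Q0 != 0 ->
  exists P Q : {poly F},
    [/\ Q != 0, coprimep P Q,
        forall z, Q0.[z] != 0 -> Q.[z] != 0 /\ P0.[z] / Q0.[z] = P.[z] / Q.[z] &
        (size P0 <= size Q0)%N -> (size P <= size Q)%N].
Proof.
move=> Q00; pose G := gcdp P0 Q0.
have PE : P0 = P0 %/ G * G by rewrite divpK // dvdp_gcdl.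
have QE : Q0 = Q0 %/ G * G by rewrite divpK // dvdp_gcdr.
have G0 : G != 0 by rewrite gcdp_eq0 negb_and Q00 orbT.
have Q0' : Q0 %/ G != 0 by apply: contraNneq Q00 => h; rewrite QE h mul0r.
exists (P0 %/ G), (Q0 %/ G); split=> //.
- by rewrite coprimep_div_gcd // Q00 orbT.
- move=> z; rewrite {1}QE hornerM mulf_eq0 negb_or => /andP[Qz Gz].
  split=> //; rewrite {1}PE {1}QE !hornerM -mulf_div divff // mulr1 //.
(* Dividing by the gcd lowers both degrees equally, so the comparison at infinity survives; a zero
   numerator has no degree to lower and is treated apart. *)
- have [->|P0'] := eqVneq (P0 %/ G) 0; first by rewrite size_poly0.
  rewrite {1}PE {1}QE !size_mul // -!subn1 leq_sub2rE; first by rewrite leq_add2r.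
  by rewrite addn_gt0 size_poly_gt0 Q0'.
Qed.

Lemma no_pole_zero (R : realType) (v : option (Cplx R)) : no_pole 0 1 v.
Proof.
case: v => [z|]; first by rewrite /no_pole hornerC oner_neq0.
by rewrite /no_pole size_poly0 leq0n.
Qed.

Theorem theorem3p1 (R : realType) (X : topologicalType) (A : atlas R X)
    (hX : compact_riemann_surface A)
    (sqrtK : cocycle A) (hsqrtK : is_sqrt_canonical sqrtK)
    (hsqrtK0 : h0_vanishes sqrtK)
    (x0 : X) (chi : (R -> X) -> Cplx R) (flat : cocycle A)
    (hflat : flat_unitary_bundle x0 chi flat)
    (htheta : h0_vanishes (tensor flat sqrtK))
    (Z : X -> option (Cplx R)) (hZ : meromorphic_map A Z)
    (Xi : X -> int) (hXi : polar_divisor A Z Xi)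
    (r : nat) (hr : deg Xi = r%:Z)
    (sh : Cplx R -> 'I_r -> X) (hsh : sheets A Z sh)
    (tr : X -> chart A) (htr : forall p, dom (tr p) p)
    (phi : 'I_r -> section A)
    (hphi : H0_basis (tensor flat sqrtK) Xi phi) :
  (forall z, ~ critical_value A Z (Some z) -> det_sections tr sh phi z != 0) /\
  (forall psi : 'I_r -> section A,
     (forall j, meromorphic_section (tensor flat sqrtK) (psi j)) ->
     (forall j p, ramification_point A Z p -> ~ has_pole (psi j) p) ->
     exists P Q : {poly Cplx R},
       [/\ Q != 0, coprimep P Q,
           forall z, ~ critical_value A Z (Some z) ->
             (forall j p, Z p = Some z -> ~ has_pole (psi j) p) ->
             Q.[z] != 0 /\
             det_sections tr sh psi z / det_sections tr sh phi z = P.[z] / Q.[z]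
         & forall v, critical_value A Z v ->
             (forall j p, Z p = v -> ~ has_pole (psi j) p) ->
             no_pole P Q v]).
Proof.
set g := tensor flat sqrtK.
have gc : continuous_cocycle g.
  apply: continuous_tensor.
    by apply: flat_bundle_continuous; case: hflat.
  by apply: holomorphic_bundle_continuous; case: hsqrtK.
have det0 z : ~ critical_value A Z (Some z) -> det_sections tr sh phi z != 0.
  exact: (det_basis_neq0 hX gc htheta hZ hXi hsh htr hphi).
split=> // psi mpsi _.
(* If every value is critical, only the clause on critical values has content,
   and the zero fraction satisfies it. *)
have [[z0 ncrit]|crit] := pselect (exists z0, ~ critical_value A Z (Some z0)); last first.
  exists 0, 1; split.
  - exact: oner_neq0.
  - by rewrite coprimep_sym coprime1p.
  - by move=> z zN; case: crit; exists z.
  - by move=> v _ _; exact: no_pole_zero.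
(* One noncritical value [z0] yields the polynomials; the resulting identities then hold over every
   finite value, critical or not, away from the poles of [psi j]. *)
have /choice[q /choice[M hM]] := fun j => section_expansion hX gc htheta hZ hXi hsh htr hphi ncrit (mpsi j).
pose P0 : {poly Cplx R} := \det (\matrix_(j < r, k < r) M j k).
pose Q0 : {poly Cplx R} := \prod_j q j.
have Q00 : Q0 != 0 by apply/prodf_neq0 => j _; case: (hM j).
have Q0z z : (forall j p, Z p = Some z -> ~ has_pole (psi j) p) -> Q0.[z] != 0.
  move=> zN; rewrite /Q0 horner_prod; apply/prodf_neq0 => j _; apply/eqP => qz.
  by case: (hM j) => _ /(_ z qz)[p Zp sp] _ _; exact: (zN j p).
have [P [Q [Q1 PQ PQz PQsize]]] := reduced_fraction P0 Q00.
exists P, Q; split=> //.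
- move=> z zcrit zN; have [Qz PQE] := PQz z (Q0z z zN); split=> //; rewrite -PQE.
  apply/eqP; rewrite eqr_div ?det0 ?Q0z //; apply/eqP.
  (* The identity over [z] is the matrix equation [diag(q_j(z)) * Psi(z) = M(z) * Phi(z)], of which
     determinants are taken. *)
  have <- : \det (diag_mx (\row_j (q j).[z])) = Q0.[z].
    by rewrite det_diag /Q0 horner_prod; apply: eq_bigr => j _; rewrite mxE.
  have <- : \det (map_mx (horner_eval z) (\matrix_(j < r, k < r) M j k)) = P0.[z].
    by rewrite det_map_mx.
  rewrite mulrC /det_sections -!det_mulmx; congr (\det _); apply/matrixP => j a.
  rewrite mul_diag_mx !mxE.
  have Zp : Z (sh z a) = Some z by have [shz _ _] := hsh z zcrit; exact: (shz a).
  have [_ _ /(_ _ _ Zp (zN j _ Zp)) -> _] := hM j.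
  by apply: eq_bigr => k _; rewrite !mxE.
- move=> [z|] _ vN /=; first by case: (PQz z (Q0z z vN)).
  (* At infinity, each term of the Leibniz expansion of [det M] has one factor [M j (s j)] per row,
     of size at most that of [q j], so its size is at most that of [Q0]. *)
  apply: PQsize; rewrite (leq_trans (size_sum _ _ _)) //; apply/bigmax_leqP => /= s _.
  rewrite mulr_sign; case: ifP => _; rewrite ?size_polyN.
  all: apply: size_prod_le => j; case: (hM j) => // _ _ _ /(_ (vN j)) Mq.
  all: by rewrite mxE Mq.
Qed.
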